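(* Consider the cache network on the $\sqrt n\times\sqrt n$ grid (torus) with $n$ servers, library size $K$, cache size $M$, and $n$ requests. Let $0<\alpha,\beta<1/2$ be two constants and let $K=n$, $M=n^{\alpha}$ and $r=n^{\beta}$. If $$\alpha+2\beta\ \ge\ 1+\frac{2\log\log n}{\log n},$$ then, under the Uniform popularity distribution ($p_i=1/K$ for all $i$), the Proximity-Aware Two Choices Strategy (Strategy II) with radius $r$ achieves maximum load $L=\Theta(\log\log n)$ and communication cost $C=\Theta(r)$ with high probability.
   Context: Network: $n$ servers are the vertices of a $\sqrt n\times\sqrt n$ grid graph $G$; to avoid boundary effects $G$ is taken to be the torus (wrap-around grid), the asymptotic results being asserted for the grid as well. $d_G(u,v)$ is the shortest-path distance and $B_r(u)=\{v: d_G(u,v)\le r\}$. Library and placement: there are $K$ files $W_1,\dots,W_K$ with popularity distribution $\mathcal P=(p_1,\dots,p_K)$. Each server independently caches $M$ files drawn i.i.d. from $\mathcal P$ with replacement. Requests: after placement, $n$ requests arrive sequentially; each request originates at a server chosen uniformly at random and asks for a file drawn from $\mathcal P$, independently. Strategy II (Proximity-Aware Two Choices Strategy with radius $r$): for each request born at a node $u$, two (distinct) nodes are chosen uniformly at random among the nodes of $B_r(u)$ that have cached the requested file, and the request is assigned to whichever of the two currently has the smaller load (number of requests assigned so far); ties are broken randomly. Maximum load: if $T_i$ is the number of requests assigned to server $i$ after all $n$ requests, then $L=\max_{1\le i\le n}T_i$. Communication cost: $C$ is the average number of hops (graph distance) between the requesting node and the serving node. Asymptotics are as $n\to\infty$ (integer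 rounding is ignored). ''With high probability'' means with probability at least $1-1/n^c$ for some constant $c>0$. *)

(* Defs.v *)
From HB Require Import structures.
From mathcomp Require Import all_boot all_order all_algebra.
From mathcomp Require Import all_classical all_reals all_analysis.

Set Implicit Arguments.
Unset Strict Implicit.
Unset Printing Implicit Defensive.

Import Order.TTheory GRing.Theory Num.Theory.

Local Open Scope ring_scope.

(* Shortest-path distance of a graph: the least length of an e-path from u to v
   (a shortest path has fewer than #|V| edges; the value is #|V| when v is not
   reachable from u). *)
Definition gdist (V : finType) (e : rel V) (u v : V) : nat :=
  find (fun k => [exists p : k.-tuple V, path e u p && (last u p == v)])
       (iota 0 #|V|).

(* ordS is the cyclic successor i |-> i + 1 mod m on 'I_m. *)
Definition cycle_adj (m : nat) : rel 'I_m :=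
  fun i j => (j == ordS i) || (i == ordS j).

Definition torus_adj (m : nat) : rel ('I_m * 'I_m)%type :=
  fun u v => (u.1 == v.1) && cycle_adj u.2 v.2
          || (u.2 == v.2) && cycle_adj u.1 v.1.

Definition unif {R : realType} (X : finType) (S : {set X}) (x : X) : R :=
  (x \in S)%:R / #|S|%:R.

Definition unif_popularity {R : realType} {K : nat} : 'I_K -> R :=
  fun=> K%:R^-1.

Section CacheNetwork.

Context {R : realType} (V : finType) (e : rel V) (K M N : nat).
Context (pop : 'I_K -> R) (r : R).

Definition ball_of (u : V) : {set V} := [set v | (gdist e u v)%:R <= r].

(* Z (v, j) is the j-th of the M files drawn, with replacement, by server v. *)
Definition placement := {ffun V * 'I_M -> 'I_K}.

Definition caches (Z : placement) (v : V) (f : 'I_K) : bool :=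
  [exists j, Z (v, j) == f].

Definition candidates (Z : placement) (u : V) (f : 'I_K) : {set V} :=
  [set v in ball_of u | caches Z v f].

(* Ordered pairs of distinct candidates.  The strategy is only specified when
   there are at least two candidates; by convention a single candidate serves
   the request, and without any candidate the origin u serves it itself. *)
Definition choice_pairs (Z : placement) (u : V) (f : 'I_K) : {set V * V} :=
  let A := candidates Z u f in
  if (1 < #|A|)%N then [set vw in finset.setX A A | vw.1 != vw.2]
  else let s := odflt u [pick v in A] in [set (s, s)].

(* (u, f, (v, w), b): origin, requested file, the two chosen servers, and the
   fair coin used to break a tie. *)
Definition request := (V * 'I_K * (V * V) * bool)%type.

Definition origin (q : request) : V := q.1.1.1.
Definition file (q : request) : 'I_K := q.1.1.2.
Definition choices (q : request) : V * V := q.1.2.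
Definition coin (q : request) : bool := q.2.

Definition request_pr (Z : placement) (q : request) : R :=
  unif [set: V] (origin q) * pop (file q)
  * unif (choice_pairs Z (origin q) (file q)) (choices q)
  * unif [set: bool] (coin q).

Definition outcome := (placement * N.-tuple request)%type.

Definition outcome_pr (w : outcome) : R :=
  (\prod_x pop (w.1 x)) * \prod_(q <- w.2) request_pr w.1 q.

Definition Pr (E : pred outcome) : R := \sum_(w | E w) outcome_pr w.

Definition serve (load : V -> nat) (q : request) : V :=
  let: (v, w) := choices q in
  if (load v < load w)%N then v
  else if (load w < load v)%N then w
  else if coin q then v else w.

Fixpoint serve_seq (load : V -> nat) (qs : seq request) : seq V :=
  if qs is q :: qs' then
    let s := serve load q in
    s :: serve_seq (fun x => load x + (x == s))%N qs'
  else [::].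

(* The server of each request, in order of arrival. *)
Definition servers (w : outcome) : seq V := serve_seq (fun=> 0%N) w.2.

Definition max_load (w : outcome) : nat :=
  (\max_(i : V) count_mem i (servers w))%N.

Definition comm_cost (w : outcome) : R :=
  (\sum_(qs <- zip w.2 (servers w)) gdist e (origin qs.1) qs.2)%:R / N%:R.

End CacheNetwork.

(* Main.v *)
(** Fix a typical placement.  Each request then draws an ordered pair of servers
    from a symmetric law whose marginals are of order [1/n] and whose atoms are
    at most [n^(-1-alpha)]: a fixed pair shares few files because [alpha < 1/2],
    and every requested file has [Theta(r^2 M / n) >> log n] holders within
    distance [r].  For a server [v] let [mass l j v] be [n] times the probability
    of drawing [v] together with a server of load at least [j].

    Upper bound: if all masses at level [j] are at most [beta], a request puts a
    server chosen with [v] above level [j] only if both its choices have load at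
    least [j], so the masses at level [j + 1] grow by at most about [4 beta^2 / n]
    per request and, by an exponential moment, end below [8 beta^2] for all [v] at
    once.  After [O(log log n)] levels the masses are below [n^(-alpha/2)], and
    then a server receives only boundedly many further requests.

    Lower bound: split the requests into [k] phases.  If all masses at level [j]
    are at least [gamma], the next phase brings all masses at level [j + 1] above
    [gamma^2 / (32 k)]; for [k] a small multiple of [log log n] the resulting
    quantity stays above [n^(-alpha/2)], so some server has load [k].

    Cost: only a small fraction of the holders within distance [r] lie within
    distance [r / 300], so a constant fraction of the requests travels farther. *)
Require Import Defs.
From HB Require Import structures.
From mathcomp Require Import all_boot all_order all_algebra.
From mathcomp Require Import all_classical all_reals all_analysis.
From mathcomp Require Import ring lra zify.

Set Implicit Arguments.
Unset Strict Implicit.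
Unset Printing Implicit Defensive.

Import Order.TTheory GRing.Theory Num.Theory.

Local Open Scope ring_scope.

(** * Expectations along a finite Markov chain *)

Section ChainExpectation.

Context {R : realType} {T : finType} {S : Type} (p : T -> R) (step : S -> T -> S).

Fixpoint chainE (N : nat) (f : S -> R) (s : S) : R :=
  if N is N'.+1 then \sum_x p x * chainE N' f (step s x) else f s.

(** Turns a sum over tuples of independent draws into a Markov chain, so that estimates for a single
    draw can be iterated. *)
Lemma chainE_foldl N f s :
  \sum_(t : N.-tuple T) (\prod_(x <- t) p x) * f (foldl step s t) = chainE N f s.
Proof.
elim: N s => [|N IH] s /=.
  rewrite (big_pred1 [tuple]) => [|t]; first by rewrite big_nil mul1r.
  by apply/esym/eqP; exact: tuple0.
rewrite (reindex (fun xt : T * N.-tuple T => [tuple of xt.1 :: xt.2])) /=; last first.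
  exists (fun t => (thead t, [tuple of behead t])) => [[x t] _|t _] /=.
    by congr (_, _); apply: val_inj.
  by rewrite -tuple_eta.
rewrite -(pair_bigA _ (fun x (t : N.-tuple T) =>
  (\prod_(y <- x :: t) p y) * f (foldl step (step s x) t))) /=.
apply: eq_bigr => x _; rewrite -IH mulr_sumr; apply: eq_bigr => t _.
by rewrite big_cons mulrA.
Qed.

Lemma chainE_add N1 N2 f s :
  chainE (N1 + N2) f s = chainE N1 (chainE N2 f) s.
Proof.
by elim: N1 s => [|N1 IH] s //=; apply: eq_bigr => x _; rewrite IH.
Qed.

Lemma chainE_sum (I : Type) (r : seq I) (P : pred I) (F : I -> S -> R) N s :
  chainE N (fun s => \sum_(i <- r | P i) F i s) s = \sum_(i <- r | P i) chainE N (F i) s.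
Proof.
elim: N s => [|N IH] s //=; rewrite exchange_big /=; apply: eq_bigr => x _.
by rewrite IH mulr_sumr.
Qed.

Lemma chainED N f g s :
  chainE N (fun s => f s + g s) s = chainE N f s + chainE N g s.
Proof.
elim: N s => [|N IH] s //=; rewrite -big_split /=; apply: eq_bigr => x _.
by rewrite IH mulrDr.
Qed.

Lemma chainEZ N c f s : chainE N (fun s => c * f s) s = c * chainE N f s.
Proof.
elim: N s => [|N IH] s //=; rewrite mulr_sumr; apply: eq_bigr => x _.
by rewrite IH mulrCA.
Qed.

Hypothesis p_ge0 : forall x, 0 <= p x.
Variable inv : S -> Prop.
Hypothesis inv_step : forall s x, inv s -> inv (step s x).

Lemma chainE_le N f g s : (forall s, inv s -> f s <= g s) -> inv s ->
  chainE N f s <= chainE N g s.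
Proof.
move=> fg; elim: N s => [|N IH] s Is /=; first exact: fg.
by apply: ler_sum => x _; apply: ler_wpM2l => //; apply/IH/inv_step.
Qed.

(** The supermartingale argument behind every tail bound below: a one-step growth factor for a
    potential is iterated, on states satisfying the preserved predicate [inv]. *)
Lemma chainE_drift N phi rho s : 0 <= rho ->
  (forall s, inv s -> \sum_x p x * phi (step s x) <= rho * phi s) -> inv s ->
  chainE N phi s <= rho ^+ N * phi s.
Proof.
move=> rho0 drift; elim: N s => [|N IH] s Is /=; first by rewrite mul1r.
apply: (@le_trans _ _ (\sum_x p x * (rho ^+ N * phi (step s x)))).
  by apply: ler_sum => x _; apply: ler_wpM2l => //; apply/IH/inv_step.
under eq_bigr do rewrite mulrCA.
rewrite -mulr_sumr exprSr -mulrA; apply: ler_wpM2l; first exact: exprn_ge0.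
exact: drift.
Qed.

Hypothesis p_sum : \sum_x p x = 1.

Lemma chainE_cst N c s : chainE N (fun=> c) s = c.
Proof.
elim: N s => [|N IH] s //=; under eq_bigr do rewrite IH.
by rewrite -mulr_suml p_sum mul1r.
Qed.

End ChainExpectation.

(** * The two-choice process for a fixed law on pairs of servers *)

(** This is [1 + t <= expR t] at [t = - x], inverted. It linearizes small exponential moments in
    both directions. *)
Lemma expR_le_inv1B {R : realType} (x : R) : x < 1 -> expR x <= (1 - x)^-1.
Proof.
move=> x1; rewrite -[expR x]invrK -expRN lef_pV2 ?posrE ?expR_gt0 ?subr_gt0 //.
exact: expR_ge1Dx.
Qed.

Lemma expR_le1D2x {R : realType} (x : R) : 0 <= x <= 2^-1 -> expR x <= 1 + 2 * x.
Proof.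
move=> /andP[x0 x1]; apply: (le_trans (expR_le_inv1B _)); first by lra.
by rewrite -div1r ler_pdivrMr; nra.
Qed.

Lemma expRN_le1Bhalf {R : realType} (x : R) : 0 <= x <= 1 -> expR (- x) <= 1 - x / 2.
Proof.
move=> /andP[x0 x1]; apply: (le_trans (expR_le_inv1B _)); first by lra.
by rewrite -div1r ler_pdivrMr; nra.
Qed.

Lemma ler_indicator {R : realType} (b : bool) (x : R) :
  0 <= x -> (b -> 1 <= x) -> b%:R <= x.
Proof. by case: b => // x0 /(_ isT). Qed.

Section TwoChoices.

Context {R : realType} (V : finType) (K : nat).
Implicit Types (l : V -> nat) (q : request V K).

Definition step l q : V -> nat := fun x => (l x + (x == serve l q))%N.

Definition bump l (s : V) : V -> nat := fun x => (l x + (x == s))%N.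

(** The rule of [serve] without origin and file, since [law] describes only the pair and the
    coin. *)
Definition server l (v w : V) (b : bool) : V :=
  if (l v < l w)%N then v else if (l w < l v)%N then w else if b then v else w.

Lemma serveE l q : serve l q = server l (choices q).1 (choices q).2 (coin q).
Proof. by rewrite /server /serve; case: (choices q). Qed.

Lemma stepE l q : step l q = bump l (server l (choices q).1 (choices q).2 (coin q)).
Proof. by rewrite /step serveE. Qed.

Lemma server_or l v w b : server l v w b = v \/ server l v w b = w.
Proof. by rewrite /server; case: ifP => _; [left|case: ifP => _; [right|case: b; [left|right]]]. Qed.

Lemma server_min l v w b :
  (l (server l v w b) <= l v)%N /\ (l (server l v w b) <= l w)%N.
Proof.
rewrite /server; case: (ltngtP (l v) (l w)) => h; rewrite ?leqnn.
- by split=> //; exact: ltnW.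
- by split=> //; exact: ltnW.
- by case: b; rewrite h leqnn.
Qed.

Context (p : request V K -> R) (a : V -> V -> R) (N : nat).
Hypothesis N_gt0 : (0 < N)%N.
Hypothesis p_ge0 : forall q, 0 <= p q.
Hypothesis p_sum : \sum_q p q = 1.
Hypothesis a_ge0 : forall v w, 0 <= a v w.
Hypothesis a_sym : forall v w, a v w = a w v.
(* [a v w] is [N] times the probability that a request draws the ordered pair
   [(v, w)]. *)
Hypothesis law : forall h : V -> V -> bool -> R,
  \sum_q p q * h (choices q).1 (choices q).2 (coin q) =
  N%:R^-1 * \sum_v \sum_w a v w * ((h v w true + h v w false) / 2).

Let N0 : 0 < N%:R :> R. Proof. by rewrite ltr0n. Qed.

Lemma sum_law : N%:R^-1 * \sum_v \sum_w a v w = 1.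
Proof.
have := law (fun _ _ _ => 1); under eq_bigr do rewrite mulr1.
rewrite p_sum => e; rewrite [RHS]e; congr (_ * _).
by apply: eq_bigr => v _; apply: eq_bigr => w _; rewrite (_ : (1 + 1) / 2 = 1) ?mulr1; lra.
Qed.

(** The two outcomes of the fair coin are bounded through their sum: in [mass_drift] a tie makes
    only one of them helpful. *)
Lemma step_le l (F : (V -> nat) -> R) (G : V -> V -> R) :
  (forall v w, F (bump l (server l v w true)) + F (bump l (server l v w false)) <= 2 * G v w) ->
  \sum_q p q * F (step l q) <= N%:R^-1 * \sum_v \sum_w a v w * G v w.
Proof.
move=> FG; under eq_bigr do rewrite stepE.
rewrite (law (fun v w b => F (bump l (server l v w b)))).
apply: ler_wpM2l; first by rewrite invr_ge0 ltW.
apply: ler_sum => v _; apply: ler_sum => w _; apply: ler_wpM2l => //.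
by have := FG v w; lra.
Qed.

Definition mass l j v := \sum_w a v w * (j <= l w)%:R.

Lemma mass_bump l s j v : mass l j v <= mass (bump l s) j v.
Proof.
apply: ler_sum => w _; apply: ler_wpM2l => //; rewrite /bump ler_nat.
by case: (leqP j (l w)) => // h; rewrite (leq_trans h) ?leq_addr.
Qed.

Lemma mass_ge0 l j v : 0 <= mass l j v.
Proof. by apply: sumr_ge0 => w _; rewrite mulr_ge0. Qed.

(** * Upper bound on the loads: light levels *)

Definition light j (beta : R) l := [forall v, mass l j v <= beta].

Lemma lightP j beta l : reflect (forall v, mass l j v <= beta) (light j beta l).
Proof. exact: forallP. Qed.

(** Masses only grow, so lightness once lost never returns. A potential multiplied by the indicator
    of lightness therefore keeps its drift bound in every state. *)
Lemma light_bump j beta l s : light j beta (bump l s) -> light j beta l.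
Proof.
by move=> /lightP h; apply/lightP => v; exact: le_trans (mass_bump l s j v) (h v).
Qed.

(** By truncated subtraction this is the sum of [mass l i v] over [i > j]. It increases only when a
    server of load at least [j] is served. *)
Definition excess j v l := \sum_w a v w * (l w - j)%:R.

Lemma excess_bump j v l s :
  excess j v (bump l s) = excess j v l + a v s * (j <= l s)%:R.
Proof.
rewrite /excess (bigD1 s) //= [in RHS](bigD1 s) //= addrAC; congr (_ + _).
  rewrite -mulrDr /bump eqxx addn1 -natrD; congr (_ * _%:R).
  case: leqP => h; first by rewrite addn1 subSn.
  by rewrite addn0 (eqP h) (eqP (ltnW h)).
by apply: eq_bigr => w /negPf ws; rewrite /bump ws addn0.
Qed.


(** The winner is the less loaded of the two, so it has load at least [j] only if both do. This
    makes the rate quadratic: one factor [beta] is the mass seen from [v], the other the mass seen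
    from the drawn server. *)
Lemma excess_drift theta j beta v l : 0 <= theta ->
  (forall v w, theta * a v w <= 2^-1) -> 0 <= beta -> light j beta l ->
  \sum_q p q * expR (theta * excess j v (step l q)) <=
  expR (4 * theta * beta ^+ 2 / N%:R) * expR (theta * excess j v l).
Proof.
move=> th0 tha b0 /lightP lt.
pose d x := (j <= l x)%:R : R.
have d01 x : 0 <= d x <= 1 by rewrite /d; case: (_ <= _)%N; rewrite ?lexx ?ler01.
pose E := expR (theta * excess j v l).
pose G x y := E * (1 + 2 * theta * (a v x + a v y) * (d x * d y)).
have E0 : 0 < E by exact: expR_gt0.
apply: (@le_trans _ _ (N%:R^-1 * \sum_x \sum_y a x y * G x y)).
  apply: (step_le (F := fun l' => expR (theta * excess j v l'))) => x y.
  suff H b : expR (theta * excess j v (bump l (server l x y b))) <= G x y.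
    by have := lerD (H true) (H false); lra.
  rewrite excess_bump mulrDr expRD ler_pM2l //.
  have [mx my] := server_min l x y b.
  have av0 : 0 <= a v x + a v y by rewrite addr_ge0.
  have : a v (server l x y b) <= a v x + a v y.
    by case: (server_or l x y b) => ->; rewrite ?lerDl ?lerDr.
  move: (server l x y b) mx my => s mx my as_.
  case: (leqP j (l s)) => js; last first.
    by rewrite !mulr0 expR0 lerDl !mulr_ge0 // ?mulr_ge0 //; case/andP: (d01 x); case/andP: (d01 y).
  rewrite /d (leq_trans js mx) (leq_trans js my) !mulr1.
  apply: (le_trans (expR_le1D2x _)); first by rewrite tha mulr_ge0.
  by rewrite lerD2l mulrA ler_wpM2l // mulr_ge0.
rewrite [leRHS]mulrC -/E.
(* By symmetry of [a] the two drawn servers contribute equally, [2 * theta] each. *)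
have -> : \sum_x \sum_y a x y * G x y =
    E * (\sum_x \sum_y a x y + 4 * theta * \sum_x a v x * d x * mass l j x).
  have -> : 4 * theta * \sum_x a v x * d x * mass l j x =
     \sum_x \sum_y a x y * (2 * theta * a v x * (d x * d y)) +
     \sum_x \sum_y a x y * (2 * theta * a v y * (d x * d y)).
    rewrite [X in _ = _ + X]exchange_big /= -big_split mulr_sumr /=.
    apply: eq_bigr => x _; rewrite /mass mulr_sumr -big_split mulr_sumr /=.
    by apply: eq_bigr => y _; rewrite (a_sym y x) -/(d y); ring.
  rewrite -!big_split mulr_sumr; apply: eq_bigr => x _ /=.
  rewrite -!big_split mulr_sumr; apply: eq_bigr => y _ /=; rewrite /G; ring.
rewrite mulrCA ler_pM2l // mulrDr sum_law.
apply: (le_trans _ (expR_ge1Dx _)); rewrite lerD2l mulrC ler_wpM2r ?invr_ge0 ?ler0n //.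
rewrite -mulrA -[leRHS]mulrA ler_wpM2l // ler_wpM2l // expr2.
apply: (@le_trans _ _ (\sum_x a v x * d x * beta)).
  by apply: ler_sum => x _; rewrite ler_wpM2l // mulr_ge0 //; case/andP: (d01 x).
by rewrite -mulr_suml ler_wpM2r //; exact: lt.
Qed.

(** Markov's inequality for the exponential potential restricted to light states. The excess starts
    at zero, and [N] steps of drift contribute the exponent [4 * theta * beta ^+ 2]. *)
Lemma excess_tail theta j beta B v : 0 <= theta ->
  (forall v w, theta * a v w <= 2^-1) -> 0 <= beta ->
  chainE p step N (fun l => (light j beta l && (B < excess j v l))%:R) (fun=> 0%N)
  <= expR (4 * theta * beta ^+ 2 - theta * B).
Proof.
move=> th0 tha b0.
pose phi l := (light j beta l)%:R * expR (theta * excess j v l).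
apply: (@le_trans _ _ (chainE p step N (fun l => expR (- (theta * B)) * phi l) (fun=> 0%N))).
  apply: (@chainE_le _ _ _ _ _ p_ge0 (fun=> True)) => // l _.
  apply: ler_indicator => [|/andP[lt h]]; first by rewrite !mulr_ge0 ?expR_ge0.
  rewrite /phi lt mul1r -expRD -[X in X <= _]expR0 ler_expR addrC subr_ge0.
  by rewrite ler_wpM2l // ltW.
rewrite chainEZ addrC expRD ler_pM2l ?expR_gt0 //.
apply: le_trans (@chainE_drift _ _ _ _ _ p_ge0 (fun=> True) _ N phi
  (expR (4 * theta * beta ^+ 2 / N%:R)) (fun=> 0%N) _ _ _) _ => //.
- move=> l _; rewrite /phi; case: (boolP (light j beta l)) => lt.
    rewrite mul1r; apply: le_trans (excess_drift v th0 tha b0 lt).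
    apply: ler_sum => q _; rewrite ler_wpM2l //.
    by case: light; rewrite ?mul1r ?mul0r ?expR_ge0.
  rewrite mul0r mulr0 big1 // => q _.
  rewrite stepE; case: (boolP (light _ _ (bump _ _))) => [/light_bump h|_].
    by rewrite h in lt.
  by rewrite mul0r mulr0.
- rewrite -expRM_natr divfK ?gt_eqF // ler_piMr ?expR_ge0 // /phi.
  rewrite /excess big1 => [|w _]; last by rewrite sub0n mulr0.
  by rewrite mulr0 expR0 mulr1; case: light.
Qed.

Lemma mass_excess i j v l : i%:R * mass l (j + i) v <= excess j v l.
Proof.
rewrite mulr_sumr; apply: ler_sum => w _; rewrite mulrCA ler_wpM2l // -natrM ler_nat.
by case: (leqP (j + i)) => h; rewrite ?muln0 // muln1 leq_subRL // (leq_trans _ h) // leq_addr.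
Qed.

(** A server of load at least [j + i] counts [i] times in the excess over [j]. The gap [i = 1] gives
    the quadratic recursion; a large gap brings the masses from a constant down to a small number at
    the start. *)
Lemma heavy_step theta i j beta beta' : 0 <= theta -> (0 < i)%N ->
  (forall v w, theta * a v w <= 2^-1) -> 0 <= beta ->
  chainE p step N (fun l => (~~ light (j + i) beta' l)%:R) (fun=> 0%N)
  <= chainE p step N (fun l => (~~ light j beta l)%:R) (fun=> 0%N)
     + #|V|%:R * expR (4 * theta * beta ^+ 2 - theta * (i%:R * beta')).
Proof.
move=> th0 i0 tha b0.
apply: (@le_trans _ _ (chainE p step N (fun l => (~~ light j beta l)%:R +
    \sum_v (light j beta l && (i%:R * beta' < excess j v l))%:R) (fun=> 0%N))).
  apply: (@chainE_le _ _ _ _ _ p_ge0 (fun=> True)) => // l _.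
  apply: ler_indicator => [|]; first by rewrite addr_ge0 // sumr_ge0.
  rewrite /light negb_forall => /existsP[v]; rewrite -ltNge => hv.
  rewrite -/(light j beta l); case: (boolP (light j beta l)) => lt; last first.
    by rewrite lerDl sumr_ge0.
  rewrite add0r (bigD1 v) //=.
  rewrite (_ : _ < _ = true) ?lerDl ?sumr_ge0 //.
  by apply: lt_le_trans (mass_excess i j v l); rewrite ltr_pM2l // ltr0n.
rewrite chainED lerD2l chainE_sum.
apply: (@le_trans _ _ (\sum_(v : V) expR (4 * theta * beta ^+ 2 - theta * (i%:R * beta')))).
  by apply: ler_sum => v _; exact: excess_tail.
by rewrite sumr_const [leRHS]mulr_natl.
Qed.

(** Server [v] rises above level [j] only when drawn with a partner of load at least [j]; the two
    orders of the pair have total weight [2 * mass l j v]. *)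
Lemma load_drift b j beta v l : 1 <= b -> 0 <= beta -> light j beta l ->
  \sum_q p q * b ^+ (step l q v - j) <=
  expR (2 * b * beta / N%:R) * b ^+ (l v - j).
Proof.
move=> b1 b0 /lightP lt.
have bp : 0 <= b - 1 by rewrite subr_ge0.
pose d x := (j <= l x)%:R : R.
have d01 x : 0 <= d x <= 1 by rewrite /d; case: (_ <= _)%N; rewrite ?lexx ?ler01.
pose E := b ^+ (l v - j).
have E0 : 0 <= E by rewrite exprn_ge0 // (le_trans ler01).
pose G x y := E * (1 + (b - 1) * ((x == v)%:R * d y + (y == v)%:R * d x)).
apply: (@le_trans _ _ (N%:R^-1 * \sum_x \sum_y a x y * G x y)).
  apply: (step_le (F := fun l' => b ^+ (l' v - j))) => x y.
  suff H c : b ^+ (bump l (server l x y c) v - j) <= G x y.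
    by have := lerD (H true) (H false); lra.
  have [mx my] := server_min l x y c.
  have G1 : E <= G x y.
    rewrite ler_peMr // lerDl; apply: mulr_ge0 => //.
    by apply: addr_ge0; apply: mulr_ge0 => //; rewrite /d ler0n.
  rewrite /bump; case: eqP => [vs|_]; last by rewrite addn0.
  case: (leqP j (l v)) => jv; last first.
    have -> : (l v + true - j = l v - j)%N.
      by rewrite addn1 (eqP jv); apply/esym/eqP; rewrite subn_eq0 ltnW.
    by [].
  rewrite addn1 subSn // exprSr /G -/E ler_wpM2l //.
  have dx : d x = 1 by rewrite /d (leq_trans _ mx) // -vs.
  have dy : d y = 1 by rewrite /d (leq_trans _ my) // -vs.
  rewrite dx dy !mulr1.
  suff : 1 <= (x == v)%:R + (y == v)%:R :> R by nra.
  by case: (server_or l x y c) vs => -> <-; rewrite eqxx ?lerDl ?lerDr.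
have -> : \sum_x \sum_y a x y * G x y =
    E * (\sum_x \sum_y a x y + 2 * (b - 1) * mass l j v).
  have -> : 2 * (b - 1) * mass l j v =
     \sum_x \sum_y a x y * ((b - 1) * ((x == v)%:R * d y)) +
     \sum_x \sum_y a x y * ((b - 1) * ((y == v)%:R * d x)).
    rewrite [X in _ = _ + X]exchange_big /= -big_split /=.
    rewrite (bigD1 v) //= [X in _ = _ + X]big1 ?addr0 => [|x /negPf xv]; last first.
      by rewrite !big1 ?addr0 // => y _; rewrite xv !(mul0r, mulr0).
    rewrite /mass -big_split mulr_sumr /=; apply: eq_bigr => y _.
    by rewrite eqxx (a_sym y v) -/(d y) /= mulr1n; ring.
  rewrite -!big_split mulr_sumr; apply: eq_bigr => x _ /=.
  rewrite -!big_split mulr_sumr; apply: eq_bigr => y _ /=; rewrite /G; ring.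
rewrite mulrCA mulrC ler_wpM2r // mulrDr sum_law.
apply: (le_trans _ (expR_ge1Dx _)); rewrite lerD2l mulrC ler_wpM2r ?invr_ge0 ?ler0n //.
have := lt v; have := mass_ge0 l j v; nra.
Qed.

(** With base [beta^-1] the total drift is [expR 2] whatever [beta] is, while each unit of load
    above [j] costs a factor [beta]. *)
Lemma load_tail j beta k v : 0 < beta <= 1 ->
  chainE p step N (fun l => (light j beta l && (j + k <= l v)%N)%:R) (fun=> 0%N)
  <= expR 2 * beta ^+ k.
Proof.
move=> /andP[b0 b1].
have b1' : 1 <= beta^-1 by rewrite invf_ge1.
pose phi l := (light j beta l)%:R * beta^-1 ^+ (l v - j).
apply: (@le_trans _ _ (chainE p step N (fun l => beta ^+ k * phi l) (fun=> 0%N))).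
  apply: (@chainE_le _ _ _ _ _ p_ge0 (fun=> True)) => // l _.
  apply: ler_indicator => [|/andP[lt h]].
    by rewrite !mulr_ge0 ?exprn_ge0 // ?invr_ge0 ltW.
  rewrite /phi lt mul1r (_ : (l v - j = k + (l v - j - k))%N); last first.
    by rewrite subnKC // leq_subRL // (leq_trans _ h) // leq_addr.
  rewrite exprD mulrA -exprMn mulfV ?gt_eqF // expr1n mul1r.
  exact: exprn_ege1.
rewrite chainEZ mulrC ler_pM2r ?exprn_gt0 //.
apply: le_trans (@chainE_drift _ _ _ _ _ p_ge0 (fun=> True) _ N phi
  (expR (2 / N%:R)) (fun=> 0%N) _ _ _) _ => //.
- move=> l _; rewrite /phi; case: (boolP (light j beta l)) => lt.
    have := load_drift v b1' (ltW b0) lt; rewrite mulfVK ?gt_eqF // mul1r.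
    apply: le_trans; apply: ler_sum => q _; rewrite ler_wpM2l //.
    case: light; rewrite ?mul1r ?mul0r ?exprn_ge0 ?invr_ge0 // ltW //.
  rewrite mul0r mulr0 big1 // => q _.
  rewrite stepE; case: (boolP (light _ _ (bump _ _))) => [/light_bump h|_].
    by rewrite h in lt.
  by rewrite mul0r mulr0.
- rewrite -expRM_natr divfK ?gt_eqF // ler_piMr ?expR_ge0 // /phi.
  by rewrite sub0n expr0 mulr1; case: light.
Qed.

(** The first [j0] levels bring the masses from [C0] to [1 / 16], the next [i] square them
    repeatedly down to the floor [d], and [load_tail] handles the last [k]. The floor keeps the
    failure of each level below [expR (- (theta * d / 2))] per server. *)
Lemma max_load_tail theta C0 d j0 i k : 0 <= theta -> 1 <= C0 -> 0 < d <= 8^-1 ->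
  (forall v w, theta * a v w <= 2^-1) -> (forall v, \sum_w a v w <= C0) ->
  128 * C0 ^+ 2 <= j0%:R ->
  chainE p step N (fun l => [exists v, (j0 + i + k <= l v)%N]%:R) (fun=> 0%N)
  <= #|V|%:R * (i.+1%:R * expR (- (theta * d / 2))
       + expR 2 * Num.max (2^-1 ^+ (2 ^ i) / 8) d ^+ k).
Proof.
move=> th0 C1 /andP[d0 d8] tha aC jC.
pose beta i : R := Num.max (2^-1 ^+ (2 ^ i) / 8) d.
have b_gt0 i' : 0 < beta i' by rewrite lt_max d0 orbT.
have b_ge0 i' := ltW (b_gt0 i').
have b_d i' : d <= beta i' by rewrite le_max lexx orbT.
(* An equality for the doubly exponential part; at the floor it is [8 * d <= 1]. The constant 8 is
   twice the 4 of the drift, so half of the new bound remains as tail exponent. *)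
have bS i' : 8 * beta i' ^+ 2 <= beta i'.+1.
  rewrite /beta /Num.max; case: ltP => _.
    by rewrite -/(Num.max _ _) le_max; apply/orP; right; nra.
  rewrite -/(Num.max _ _) le_max; apply/orP; left.
  by rewrite expnS mulnC exprM; set x := _ ^+ (2 ^ _); nra.
have b1 i' : beta i' <= 1.
  rewrite ge_max; apply/andP; split; last by lra.
  have : (2^-1 : R) ^+ (2 ^ i') <= 1 by apply: exprn_ile1; lra.
  by lra.
have heavy i' : chainE p step N (fun l => (~~ light (j0 + i') (beta i') l)%:R) (fun=> 0%N)
    <= i'.+1%:R * (#|V|%:R * expR (- (theta * d / 2))).
  elim: i' => [|i' IH].
    have j00 : (0 < j0)%N by rewrite -(ltr0n R); nra.
    (* Level 0 is light with bound [C0] in every state, and [j0 * (1 / 16) >= 8 * C0 ^+ 2]. *)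
    have := @heavy_step theta j0 0 C0 (beta 0%N) th0 j00 tha (le_trans ler01 C1).
    rewrite add0n addn0 mul1r => /le_trans; apply.
    rewrite -[leRHS]add0r; apply: lerD.
      rewrite (_ : (fun l => _) = fun=> 0) ?chainE_cst //.
      apply/funext => l; case: (boolP (light 0 C0 l)) => // /lightP[] v.
      by rewrite /mass; under eq_bigr do rewrite leq0n mulr1; exact: aC.
    rewrite ler_wpM2l // ler_expR.
    have : 1 / 16 <= beta 0%N by rewrite le_max expn0 expr1; apply/orP; left; lra.
    have Cd : d / 2 <= 4 * C0 ^+ 2 by nra.
    move=> b16.
    suff : theta * (d / 2) + theta * (4 * C0 ^+ 2) <= theta * (j0%:R * beta 0%N).
      by rewrite expr2 => h; rewrite -!mulrA -expr2 in h *; lra.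
    rewrite -mulrDr ler_wpM2l //; apply: (@le_trans _ _ (j0%:R * (1 / 16))).
      by lra.
    by rewrite ler_wpM2l.
  have := @heavy_step theta 1 (j0 + i') (beta i') (beta i'.+1) th0 (ltn0Sn 0) tha (b_ge0 i').
  rewrite -addnA addn1 => /le_trans; apply.
  rewrite [leRHS]mulrC [i'.+2%:R]mulrS mulrDr mulr1 addrC; apply: lerD; last first.
    by rewrite mulrC.
  rewrite ler_wpM2l // ler_expR mul1r.
  have := bS i'; have := b_d i'.+1; move: (beta i') (beta i'.+1) => x y dy xy.
  suff : theta * (4 * x ^+ 2) + theta * (d / 2) <= theta * y.
    by rewrite !mulrA; lra.
  by rewrite -mulrDr ler_wpM2l //; lra.
apply: (@le_trans _ _ (chainE p step N (fun l => (~~ light (j0 + i) (beta i) l)%:R +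
    \sum_v (light (j0 + i) (beta i) l && (j0 + i + k <= l v)%N)%:R) (fun=> 0%N))).
  apply: (@chainE_le _ _ _ _ _ p_ge0 (fun=> True)) => // l _.
  apply: ler_indicator => [|/existsP[v lv]]; first by rewrite addr_ge0 // sumr_ge0.
  case: (light _ _ l); last by rewrite lerDl sumr_ge0.
  by rewrite add0r (bigD1 v) //= lv lerDl sumr_ge0.
rewrite chainED mulrDr; apply: lerD.
  by rewrite mulrCA; exact: heavy.
rewrite chainE_sum.
apply: (@le_trans _ _ (\sum_(v : V) expR 2 * beta i ^+ k)).
  by apply: ler_sum => v _; apply: load_tail; rewrite b_gt0 b1.
by rewrite sumr_const [leRHS]mulr_natl.
Qed.

(** * Lower bound on the loads: ample levels *)

Definition ample j (gamma : R) l := [forall v, gamma <= mass l j v].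

Lemma ampleP j gamma l : reflect (forall v, gamma <= mass l j v) (ample j gamma l).
Proof. exact: forallP. Qed.

Lemma ample_step j gamma l q : ample j gamma l -> ample j gamma (step l q).
Proof.
rewrite stepE => /ampleP h; apply/ampleP => v.
exact: le_trans (h v) (mass_bump _ _ _ _).
Qed.

Lemma massS_bump l s j v :
  mass (bump l s) j.+1 v = mass l j.+1 v + a v s * (l s == j)%:R.
Proof.
rewrite /mass (bigD1 s) //= [in RHS](bigD1 s) //= addrAC; congr (_ + _).
  rewrite -mulrDr /bump eqxx addn1 -natrD; congr (_ * _%:R).
  by rewrite ltnS; case: ltngtP => // ->.
by apply: eq_bigr => w /negPf ws; rewrite /bump ws addn0.
Qed.

Lemma massB l j v : mass l j v - mass l j.+1 v = \sum_w a v w * (l w == j)%:R.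
Proof.
rewrite -sumrB; apply: eq_bigr => w _; rewrite -mulrBr.
by case: ltngtP => _; rewrite ?subrr ?subr0.
Qed.

(** As long as level [j + 1] has mass at most [gamma / 2], servers of load exactly [j] keep weight
    at least [gamma / 2] from [v]. Such a server, drawn first with a partner of load at least [j],
    wins with probability at least one half and then enters level [j + 1]. *)
Lemma mass_drift theta j gamma v l : 0 <= theta ->
  (forall v w, theta * a v w <= 2^-1) -> 0 <= gamma -> ample j gamma l ->
  mass l j.+1 v <= gamma / 2 ->
  \sum_q p q * expR (- (theta * mass (step l q) j.+1 v)) <=
  expR (- (theta * gamma ^+ 2 / 8 / N%:R)) * expR (- (theta * mass l j.+1 v)).
Proof.
move=> th0 tha g0 /ampleP am mg.
pose E := expR (- (theta * mass l j.+1 v)).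
have E0 : 0 < E by exact: expR_gt0.
pose G x y := E * (1 - theta / 4 * (a v x * (l x == j)%:R * (j <= l y)%:R)).
apply: (@le_trans _ _ (N%:R^-1 * \sum_x \sum_y a x y * G x y)).
  apply: (step_le (F := fun l' => expR (- (theta * mass l' j.+1 v)))) => x y.
  rewrite !massS_bump !mulrDr !opprD !expRD -/E -mulrDr /G [leRHS]mulrCA ler_pM2l //.
  have e1 s b : expR (- (theta * (a v s * (nat_of_bool b)%:R))) <= 1.
    by rewrite expR_le1 oppr_le0 mulr_ge0 // mulr_ge0.
  have ex : expR (- (theta * (a v x * 1))) <= 1 - theta / 4 * a v x * 2.
    rewrite mulr1; apply: (le_trans (expRN_le1Bhalf _)); last by lra.
    by rewrite mulr_ge0 //= (le_trans (tha v x)) //; lra.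
  have ax : 0 <= theta / 4 * a v x by rewrite mulr_ge0 // mulr_ge0 //; lra.
  case: (eqVneq (l x) j) => [lx|_]; last first.
    by rewrite mulr0 mul0r mulr0 subr0 mulr1; apply: (le_trans (lerD (e1 _ _) (e1 _ _))); lra.
  case: (leqP j (l y)) => [|_]; last first.
    by rewrite !mulr0 subr0 mulr1; apply: (le_trans (lerD (e1 _ _) (e1 _ _))); lra.
  (* At a tie one value of the coin selects [x] and the other outcome is bounded by 1; against a
     larger load [x] wins for both values. *)
  rewrite leq_eqVlt => /orP[/eqP ly|ly].
    rewrite /server lx -ly ltnn lx eqxx; apply: (le_trans (lerD ex (e1 _ _))).
    by rewrite /= mulr1n !mulr1; lra.
  rewrite /server lx ly lx eqxx; apply: (le_trans (lerD ex ex)).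
  by rewrite /= mulr1n !mulr1; lra.
have -> : \sum_x \sum_y a x y * G x y =
    E * (\sum_x \sum_y a x y - theta / 4 * \sum_x a v x * (l x == j)%:R * mass l j x).
  rewrite mulr_sumr -sumrB mulr_sumr; apply: eq_bigr => x _.
  rewrite mulr_sumr mulr_sumr -sumrB mulr_sumr; apply: eq_bigr => y _.
  by rewrite /G; ring.
rewrite mulrCA mulrC ler_pM2r // mulrBr sum_law.
apply: (le_trans _ (expR_ge1Dx _)); rewrite lerD2l lerN2 [leRHS]mulrC ler_wpM2r ?invr_ge0 ?ler0n //.
apply: (@le_trans _ _ (theta / 4 * (gamma / 2 * gamma))); first by lra.
apply: ler_wpM2l; first by rewrite divr_ge0.
apply: (@le_trans _ _ (\sum_x a v x * (l x == j)%:R * gamma)); last first.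
  by apply: ler_sum => x _; rewrite ler_wpM2l // mulr_ge0.
rewrite -mulr_suml ler_wpM2r // -massB.
by have := am v; lra.
Qed.

(** A union bound over [v]. While the target [gamma'] is missed, [gamma' <= gamma / 2] keeps
    [mass_drift] applicable; states that have reached the target count zero in the potential. *)
Lemma ample_next theta j gamma gamma' n l : 0 <= theta ->
  (forall v w, theta * a v w <= 2^-1) -> 0 <= gamma -> gamma' <= gamma / 2 ->
  ample j gamma l ->
  chainE p step n (fun l => (~~ ample j.+1 gamma' l)%:R) l
  <= #|V|%:R * expR (theta * gamma' - n%:R * (theta * gamma ^+ 2 / 8 / N%:R)).
Proof.
move=> th0 tha g0 gg am.
pose phi v l := (mass l j.+1 v < gamma')%R%:R * expR (- (theta * mass l j.+1 v)).
apply: (@le_trans _ _ (chainE p step n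
    (fun l => expR (theta * gamma') * \sum_v phi v l) l)).
  apply: (@chainE_le _ _ _ _ _ p_ge0 (fun=> True)) => // l' _.
  have phi0 v : 0 <= phi v l' by rewrite mulr_ge0 ?expR_ge0.
  apply: ler_indicator => [|]; first by rewrite mulr_ge0 ?expR_ge0 // sumr_ge0.
  rewrite negb_forall => /existsP[v]; rewrite -ltNge => hv.
  apply: (@le_trans _ _ (expR (theta * gamma') * phi v l')).
    rewrite /phi hv mul1r -expRD -[X in X <= _]expR0 ler_expR subr_ge0.
    by rewrite ler_wpM2l // ltW.
  by rewrite ler_pM2l ?expR_gt0 // (bigD1 v) //= lerDl sumr_ge0.
rewrite chainEZ chainE_sum expRD mulrCA ler_pM2l ?expR_gt0 //.
apply: (@le_trans _ _ (\sum_(v : V) expR (- (n%:R * (theta * gamma ^+ 2 / 8 / N%:R))))); last first.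
  by rewrite sumr_const [leRHS]mulr_natl.
apply: ler_sum => v _.
apply: le_trans (@chainE_drift _ _ _ _ _ p_ge0 (ample j gamma) _ n (phi v)
  (expR (- (theta * gamma ^+ 2 / 8 / N%:R))) l _ _ am) _.
- by move=> l' q; exact: ample_step.
- exact: expR_ge0.
- move=> l' am'; rewrite /phi; case: (ltP (mass l' _ _) gamma') => h.
    rewrite mul1r; apply: le_trans (mass_drift th0 tha g0 am' (le_trans (ltW h) gg)).
    apply: ler_sum => q _; rewrite ler_wpM2l //.
    by case: (_ < _); rewrite ?mul1r ?mul0r ?expR_ge0.
  rewrite mul0r mulr0 big1 // => q _; rewrite ltNge stepE.
  by rewrite (le_trans h (mass_bump _ _ _ _)) mul0r mulr0.
- rewrite -expRM_natl mulrN ler_piMr ?expR_ge0 // /phi mulr_ile1 ?expR_ge0 //.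
    by case: (_ < _).
  by rewrite expR_le1 oppr_le0 mulr_ge0 // mass_ge0.
Qed.

(** The thresholds [g i] solve [g (i + 1) = g i ^+ 2 / (32 * k)] with [g 0 = c0]. Since
    [n >= N / (2 * k)], a phase gives twice the exponent [theta * g (i + 1)] lost to the target. A
    positive mass at level [k] exhibits a server of load at least [k]. *)
Lemma low_load_tail theta c0 k n : 0 <= theta -> 0 < c0 <= 1 -> (0 < #|V|)%N ->
  (forall v w, theta * a v w <= 2^-1) -> (forall v, c0 <= \sum_w a v w) ->
  (0 < k)%N -> (k * n <= N <= 2 * k * n)%N ->
  chainE p step N (fun l => [forall w, (l w < k)%N]%:R) (fun=> 0%N)
  <= k%:R * (#|V|%:R *
       expR (- (theta * (32 * k%:R * (c0 / (32 * k%:R)) ^+ (2 ^ k))))).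
Proof.
move=> th0 /andP[c00 c01] V0 tha ac k0 /andP[kn Nkn].
have k1 : 1 <= k%:R :> R by rewrite ler1n.
pose x : R := c0 / (32 * k%:R).
have x0 : 0 < x by rewrite divr_gt0 //; lra.
have x1 : x <= 1 / 32 by rewrite ler_pdivrMr; nra.
pose g i : R := 32 * k%:R * x ^+ (2 ^ i).
have g0 i : 0 < g i by rewrite !mulr_gt0 ?exprn_gt0 //; lra.
have gS i : g i.+1 * (32 * k%:R) = g i ^+ 2.
  by rewrite /g expnS mulnC exprM; ring.
have gle i : g i.+1 <= g i / 2.
  have xx : x ^+ (2 ^ i) <= x by rewrite -[leRHS]expr1 ler_wiXn2l ?expn_gt0 //; lra.
  rewrite /g expnS mulnC exprM; set y := x ^+ _ in xx *.
  have y0 : 0 < y by exact: exprn_gt0.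
  rewrite -!mulrA ler_pM2l // ler_pM2l; nra.
have gmono i j : (i <= j)%N -> g j <= g i.
  move=> /subnKC <-; elim: (j - i)%N => [|m IH]; first by rewrite addn0.
  by rewrite addnS; apply: le_trans IH; have := gle (i + m)%N; have := g0 (i + m)%N; lra.
have phase i : (i <= k)%N -> chainE p step (i * n) (fun l => (~~ ample i (g i) l)%:R) (fun=> 0%N)
    <= i%:R * (#|V|%:R * expR (- (theta * g k))).
  elim: i => [|i IH] ik.
    rewrite mul0n /= mul0r; case: (boolP (ample _ _ _)) => // /ampleP[] v.
    rewrite /mass; under eq_bigr do rewrite leq0n mulr1.
    by rewrite /g expn0 expr1 /x mulrC divfK //; have := ac v => //; lra.
  rewrite mulSn addnC chainE_add.
  pose fail := #|V|%:R * expR (- (theta * g k)).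
  apply: (@le_trans _ _ (chainE p step (i * n)
     (fun l => (~~ ample i (g i) l)%:R + fail) (fun=> 0%N))); last first.
    rewrite chainED chainE_cst // mulrS mulrDl mul1r addrC lerD2l.
    by apply: IH; exact: ltnW.
  have fail0 : 0 <= fail by rewrite mulr_ge0 ?expR_ge0.
  apply: (@chainE_le _ _ _ _ _ p_ge0 (fun=> True)) => // l _.
  case: (boolP (ample i (g i) l)) => am; last first.
    apply: (@le_trans _ _ 1); last by rewrite lerDl.
    rewrite -[leRHS](@chainE_cst _ _ _ p step p_sum n 1 l).
    apply: (@chainE_le _ _ _ _ _ p_ge0 (fun=> True)) => // l' _.
    by case: (~~ _).
  rewrite add0r; apply: le_trans (ample_next n th0 tha (ltW (g0 i)) (gle i) am) _.
  rewrite ler_wpM2l // ler_expR.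
  have gk : theta * g k <= theta * g i.+1 by rewrite ler_wpM2l // gmono.
  suff : 2 * (theta * g i.+1) <= n%:R * (theta * g i ^+ 2 / 8 / N%:R) by lra.
  rewrite -gS [leRHS]mulrA ler_pdivlMr //.
  have tg : 0 <= theta * g i.+1 by rewrite mulr_ge0 // ltW.
  have NN : N%:R <= 2 * k%:R * n%:R :> R by rewrite -!natrM ler_nat.
  apply: (@le_trans _ _ (2 * (theta * g i.+1) * (2 * k%:R * n%:R))).
    by rewrite ler_wpM2l // mulr_ge0.
  by rewrite le_eqVlt; apply/orP; left; apply/eqP; field.
(* The requests left after the last phase never lower a load, so level [k] stays ample to the
   end. *)
rewrite -(subnKC kn) chainE_add; apply: le_trans (phase k (leqnn k)).
apply: (@chainE_le _ _ _ _ _ p_ge0 (fun=> True)) => // l _.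
case: (boolP (ample k (g k) l)) => am /=.
  rewrite -[leRHS](@chainE_cst _ _ _ p step p_sum (N - k * n) 0 l).
  apply: (@chainE_le _ _ _ _ _ p_ge0 (ample k (g k))) => // [l' q|l' /ampleP am'].
    exact: ample_step.
  case: (boolP [forall _, _]) => // /forallP low.
  have /card_gt0P[v _] := V0.
  have := lt_le_trans (g0 k) (am' v); rewrite /mass big1 ?ltxx // => w _.
  by rewrite leqNgt low mulr0.
rewrite -[leRHS](@chainE_cst _ _ _ p step p_sum (N - k * n) 1 l).
apply: (@chainE_le _ _ _ _ _ p_ge0 (fun=> True)) => // l' _.
by case: [forall _, _].
Qed.
End TwoChoices.

(** * Uniform random placements *)

Section UniformDraws.

Context {R : realType} (I : finType) (K : nat).
Hypothesis K_gt0 : (0 < K)%N.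
Implicit Types (Z : {ffun I -> 'I_K}) (A : {set I}) (F : {set 'I_K}).

Definition drawE (f : {ffun I -> 'I_K} -> R) : R :=
  \sum_(Z : {ffun I -> 'I_K}) (\prod_x unif_popularity (Z x)) * f Z.

Let K0 : 0 < K%:R :> R. Proof. by rewrite ltr0n. Qed.

Lemma drawE_prod (g : I -> 'I_K -> R) :
  drawE (fun Z => \prod_x g x (Z x)) = \prod_x (K%:R^-1 * \sum_k g x k).
Proof.
under [RHS]eq_bigr do rewrite mulr_sumr.
by rewrite bigA_distr_bigA; apply: eq_bigr => Z _; rewrite -big_split.
Qed.

Lemma draw_pr_ge0 Z : 0 <= \prod_x unif_popularity (Z x) :> R.
Proof. by apply: prodr_ge0 => x _; rewrite invr_ge0. Qed.

Lemma drawE_le f g : (forall Z, f Z <= g Z) -> drawE f <= drawE g.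
Proof. by move=> fg; apply: ler_sum => Z _; rewrite ler_wpM2l // draw_pr_ge0. Qed.

Lemma drawEZ c f : drawE (fun Z => c * f Z) = c * drawE f.
Proof. by rewrite mulr_sumr; apply: eq_bigr => Z _; rewrite mulrCA. Qed.

Lemma drawE_sum (J : Type) (r : seq J) (P : pred J) (f : J -> {ffun I -> 'I_K} -> R) :
  drawE (fun Z => \sum_(j <- r | P j) f j Z) = \sum_(j <- r | P j) drawE (f j).
Proof.
rewrite /drawE exchange_big /=; apply: eq_bigr => Z _; by rewrite mulr_sumr.
Qed.

Lemma drawE1 : drawE (fun=> 1) = 1.
Proof.
have := drawE_prod (fun _ _ => 1); under [in RHS]eq_bigr => x _ do
  rewrite sumr_const card_ord mulVf ?gt_eqF //.
rewrite big1 // => <-; apply: eq_bigr => Z _; by rewrite big1.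
Qed.

Definition hits A F Z := #|[set x in A | Z x \in F]|.

Lemma sum_mem_const F (c : R) :
  K%:R^-1 * \sum_k (if k \in F then c else 1) = 1 + (c - 1) * (#|F|%:R / K%:R).
Proof.
have -> : \sum_k (if k \in F then c else 1) = K%:R + (c - 1) * #|F|%:R.
  rewrite (eq_bigr (fun k => 1 + (c - 1) * (k \in F)%:R)); last first.
    by move=> k _; case: (k \in F); rewrite ?mulr1 ?mulr0 ?addr0 // addrC subrK.
  rewrite big_split /= sumr_const card_ord -mulr_sumr; congr (_ + _ * _).
  by rewrite -natr_sum -sum1_card [in RHS]big_mkcond; congr (_%:R).
by rewrite mulrDr mulVf ?gt_eqF //; congr (_ + _); ring.
Qed.

(** The power splits over the draws, and by independence each draw in [A] contributes the same
    factor. *)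
Lemma hits_mgf A F (c : R) :
  drawE (fun Z => c ^+ hits A F Z) = (1 + (c - 1) * (#|F|%:R / K%:R)) ^+ #|A|.
Proof.
pose g x k : R := if x \in A then (if k \in F then c else 1) else 1.
transitivity (drawE (fun Z => \prod_x g x (Z x))).
  apply: eq_bigr => Z _; congr (_ * _); rewrite /hits -sum1_card.
  rewrite -prodrXr big_mkcond /=; apply: eq_bigr => x _.
  by rewrite inE /g; case: (x \in A).
rewrite drawE_prod -prodr_const [RHS]big_mkcond /=; apply: eq_bigr => x _.
rewrite /g; case: (x \in A); first exact: sum_mem_const.
by rewrite sumr_const card_ord mulVf ?gt_eqF.
Qed.

(** A Chernoff bound for both signs of [t]: multiplying the event by [t] makes it an upper tail for
    [t > 0] and a lower tail for [t < 0]. *)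
Lemma hits_tail A F (t x : R) :
  drawE (fun Z => (0 <= t * (hits A F Z)%:R - t * x)%R%:R) <=
  expR ((expR t - 1) * (#|A|%:R * #|F|%:R / K%:R) - t * x).
Proof.
apply: (@le_trans _ _ (drawE (fun Z => expR (- (t * x)) * expR t ^+ hits A F Z))).
  apply: drawE_le => Z; apply: ler_indicator => [|h].
    by rewrite mulr_ge0 ?exprn_ge0 ?expR_ge0.
  by rewrite -expRM_natr -expRD -[X in X <= _]expR0 ler_expR addrC.
rewrite drawEZ hits_mgf [X in _ <= expR X]addrC expRD ler_pM2l ?expR_gt0 //.
have -> : (expR t - 1) * (#|A|%:R * #|F|%:R / K%:R) =
  (expR t - 1) * (#|F|%:R / K%:R) * #|A|%:R by ring.
rewrite expRM_natr lerXn2r ?nnegrE ?expR_ge0 ?expR_ge1Dx //.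
have : 0 <= #|F|%:R / K%:R :> R by rewrite divr_ge0.
have : #|F|%:R / K%:R <= 1 :> R.
  by rewrite ler_pdivrMr // mul1r ler_nat -[leqRHS](card_ord K) max_card.
have := expR_ge0 t; nra.
Qed.

Lemma hits_upper_tail A F (x : R) :
  drawE (fun Z => (x <= (hits A F Z)%:R)%R%:R) <= expR (#|A|%:R * #|F|%:R / K%:R - x / 2).
Proof.
apply: (@le_trans _ _ (drawE (fun Z => (0 <= 2^-1 * (hits A F Z)%:R - 2^-1 * x)%R%:R))).
  by apply: drawE_le => Z; rewrite -mulrBr pmulr_rge0 ?subr_ge0 ?lexx.
apply: le_trans (hits_tail _ _ _ _) _; rewrite ler_expR [x / 2]mulrC lerD2r.
rewrite ler_piMl ?divr_ge0 ?mulr_ge0 //.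
by have /= := @expR_le1D2x R 2^-1; rewrite lexx invr_ge0 ler0n => /(_ isT); lra.
Qed.

Lemma hits_lower_tail A F (x : R) :
  drawE (fun Z => ((hits A F Z)%:R <= x)%R%:R) <= expR (x - #|A|%:R * #|F|%:R / K%:R / 2).
Proof.
apply: (@le_trans _ _ (drawE (fun Z => (0 <= -1 * (hits A F Z)%:R - -1 * x)%R%:R))).
  by apply: drawE_le => Z; rewrite !mulN1r opprK addrC subr_ge0.
apply: le_trans (hits_tail _ _ _ _) _; rewrite ler_expR mulN1r opprK addrC lerD2l.
have : 0 <= #|A|%:R * #|F|%:R / K%:R :> R by rewrite divr_ge0 ?mulr_ge0.
by have := @expRN_le1Bhalf R 1; rewrite lexx ler01 => /(_ isT); nra.
Qed.

(** The choice of [expR t] as the inverse of the mean bounds the first term of the exponent by 1 and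
    turns [expR (- (t * k))] into the [k]-th power of the mean. *)
Lemma hits_many_tail A F k : (0 < #|A| * #|F| <= K)%N ->
  drawE (fun Z => (k <= hits A F Z)%N%:R) <=
  expR 1 * (#|A|%:R * #|F|%:R / K%:R) ^+ k.
Proof.
move=> /andP[AF AFK]; set y : R := #|A|%:R * #|F|%:R / K%:R.
have y0 : 0 < y by rewrite /y -natrM divr_gt0 // ltr0n.
have y1 : y <= 1 by rewrite /y -natrM ler_pdivrMr // mul1r ler_nat.
have ey : expR (ln y^-1) = y^-1 by rewrite lnK // posrE invr_gt0.
apply: (@le_trans _ _ (drawE (fun Z => (0 <= ln y^-1 * (hits A F Z)%:R - ln y^-1 * k%:R)%R%:R))).
  apply: drawE_le => Z; apply: ler_indicator => // h.
  by rewrite -mulrBr mulr_ge0 ?ln_ge0 ?invf_ge1 // subr_ge0 ler_nat.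
apply: le_trans (hits_tail _ _ _ _) _.
rewrite -/y ey expRD; apply: ler_pM; rewrite ?expR_ge0 // ?ler_expR.
  by rewrite mulrBl mulVf ?gt_eqF // mul1r lerBlDr lerDl ltW.
by rewrite -mulNr lnV ?posrE // opprK expRM_natr lnK.
Qed.

End UniformDraws.

(** * Random caches: shared files and numbers of holders *)

Section RandomPlacement.

Context {R : realType} (V : finType) (K M : nat).
Hypothesis K_gt0 : (0 < K)%N.
Implicit Types (Z : placement V K M) (v w : V) (f : 'I_K) (T : {set V}).

Let K0 : 0 < K%:R :> R. Proof. by rewrite ltr0n. Qed.

Definition stored Z v : {set 'I_K} := [set f | caches Z v f].

(** Given the row of [v], the draws of [w] are still independent and each falls among the at most
    [M] files of [v] with probability at most [M / K]. Counting draws instead of distinct files only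
    enlarges the number. *)
Lemma shared_tail v w (x : R) : v != w ->
  drawE (fun Z => (x <= #|stored Z v :&: stored Z w|%:R)%R%:R) <=
  expR (M%:R * M%:R / K%:R - x / 2).
Proof.
move=> vw; pose c : R := expR 2^-1.
have c1 : 1 <= c by rewrite -[X in X <= _]expR0 ler_expR invr_ge0.
have c2 : c - 1 <= 1.
  by have /= := @expR_le1D2x R 2^-1; rewrite lexx invr_ge0 ler0n => /(_ isT); rewrite -/c; lra.
have c0 : 0 <= c by lra.
pose row Z := [ffun j => Z (v, j)].
pose X Z := #|[set j | Z (w, j) \in codom (row Z)]|.
have sX Z : (#|stored Z v :&: stored Z w| <= X Z)%N.
  apply: leq_trans (leq_imset_card (fun j => Z (w, j)) [set j | Z (w, j) \in codom (row Z)]).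
  apply: subset_leq_card; apply/fintype.subsetP => f; rewrite !inE => /andP[/existsP[i /eqP fi] /existsP[j /eqP fj]].
  apply/imsetP; exists j => //; rewrite inE fj; apply/codomP; exists i.
  by rewrite ffunE.
apply: (@le_trans _ _ (drawE (fun Z => expR (- (x / 2)) * c ^+ X Z))).
  apply: drawE_le => Z; apply: ler_indicator => [|h].
    by rewrite mulr_ge0 ?exprn_ge0 ?expR_ge0.
  rewrite /c -expRM_natr -expRD -[X in X <= _]expR0 ler_expR.
  have : (#|stored Z v :&: stored Z w|%:R : R) <= (X Z)%:R by rewrite ler_nat.
  by lra.
rewrite drawEZ addrC expRD ler_pM2l ?expR_gt0 //.
pose g (z : {ffun 'I_M -> 'I_K}) (y : V * 'I_M) (k : 'I_K) : R :=
  if y.1 == v then (k == z y.2)%:R else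
  if y.1 == w then (if k \in codom z then c else 1) else 1.
have prodE (G : V * 'I_M -> R) : (forall y, y.1 != v -> y.1 != w -> G y = 1) ->
    \prod_y G y = (\prod_j G (v, j)) * \prod_j G (w, j).
  move=> G1; rewrite (eq_bigr (fun y => G (y.1, y.2))); last by case=> [? ?].
  rewrite -(pair_bigA _ (fun u j => G (u, j))) /= (bigD1 v) //=.
  rewrite (bigD1 w) /=; last by rewrite eq_sym.
  rewrite [X in _ * (_ * X)]big1 ?mulr1 // => u /andP[uv uw].
  by rewrite big1 // => j _; rewrite G1.
have wv : (w == v) = false by rewrite eq_sym; exact: negbTE.
(* Conditioning on the row of [v]: the indicator factors in [g] leave only the term where [z] is
   that row, and each term is a product over draws. *)
have -> : drawE (fun Z => c ^+ X Z) =
    \sum_(z : {ffun 'I_M -> 'I_K}) drawE (fun Z => \prod_y g z y (Z y)).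
  rewrite -drawE_sum; apply: eq_bigr => Z _; congr (_ * _).
  rewrite (bigD1 (row Z)) //= [X in _ = _ + X]big1 ?addr0.
    rewrite prodE; last by move=> y /negPf yv /negPf yw; rewrite /g yv yw.
    rewrite big1 ?mul1r; last by move=> j _; rewrite /g eqxx ffunE eqxx.
    rewrite /X -prodr_const [LHS]big_mkcond; apply: eq_bigr => j _.
    by rewrite /g wv eqxx inE.
  move=> z zr; have [j zj] : exists j, z j != Z (v, j).
    apply/existsP; rewrite -negb_forall; apply: contra zr => /forallP e.
    by apply/eqP/ffunP => j; rewrite ffunE; apply/eqP.
  by rewrite (bigD1 (v, j)) //= /g eqxx /= eq_sym (negbTE zj) mul0r.
apply: (@le_trans _ _ (\sum_(z : {ffun 'I_M -> 'I_K})
    (\prod_(j : 'I_M) K%:R^-1) * expR (M%:R * M%:R / K%:R))).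
  apply: ler_sum => z _; rewrite drawE_prod //.
  rewrite prodE; last first.
    move=> y /negPf yv /negPf yw.
    by rewrite /g yv yw sumr_const card_ord mulVf ?gt_eqF.
  apply: ler_pM.
  - by apply: prodr_ge0 => j _; rewrite mulr_ge0 ?invr_ge0 // sumr_ge0 // /g eqxx.
  - apply: prodr_ge0 => j _; rewrite mulr_ge0 ?invr_ge0 // sumr_ge0 // => k _.
    by rewrite /g wv eqxx; case: ifP.
  - rewrite le_eqVlt; apply/orP; left; apply/eqP; apply: eq_bigr => j _.
    rewrite (bigD1 (z j)) //= /g !eqxx big1 ?addr0 ?mulr1 // => k /negPf kz.
    by rewrite kz.
  apply: (@le_trans _ _ (\prod_(j < M) expR (M%:R / K%:R))).
    apply: ler_prod => j _; rewrite /g wv eqxx.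
    rewrite (eq_bigr (fun k => if k \in [set k | k \in codom z] then c else 1)); last first.
      by move=> k _; rewrite inE.
    rewrite sum_mem_const //; set s := #|_|.
    have sM : (s%:R : R) <= M%:R.
      rewrite ler_nat /s cardsE -[leqRHS](card_ord M) -[leqRHS](size_image z).
      exact: card_size.
    have sK : 0 <= s%:R / K%:R :> R by rewrite divr_ge0.
    apply/andP; split; first by rewrite addr_ge0 // mulr_ge0 // subr_ge0.
    apply: (le_trans _ (expR_ge1Dx _)); rewrite lerD2l.
    apply: (@le_trans _ _ (s%:R / K%:R)); first by rewrite ler_piMl.
    by rewrite ler_wpM2r // invr_ge0.
  by rewrite prodr_const card_ord -expRM_natr mulrAC.
rewrite -mulr_suml [X in X * _](_ : _ = 1) ?mul1r //.
rewrite sumr_const prodr_const card_ffun !card_ord -[LHS]mulr_natr natrX.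
by rewrite -exprMn mulVf ?gt_eqF // expr1n.
Qed.

Definition copies Z v f := #|[set j | Z (v, j) == f]|.

(** All draws made by servers of [T]; hits of [[set f]] in it are copies of [f] with multiplicity,
    to which the Chernoff bounds apply. *)
Definition block T : {set V * 'I_M} := [set y | y.1 \in T].

Lemma card_block T : #|block T| = (#|T| * M)%N.
Proof.
rewrite -[in RHS](card_ord M) -cardsT -cardsX; apply: eq_card => y.
by rewrite !inE andbT.
Qed.

Lemma hits_copies T f Z : hits (block T) [set f] Z = (\sum_(v in T) copies Z v f)%N.
Proof.
rewrite /hits -sum1_card (eq_bigl (fun y => (y.1 \in T) && (Z (y.1, y.2) == f))).
  rewrite -(pair_big_dep (mem T) (fun v j => Z (v, j) == f) (fun _ _ => 1%N)) /=.
  by apply: eq_bigr => v _; rewrite /copies -sum1_card; apply: eq_bigl => j; rewrite inE.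
by move=> [v j]; rewrite !inE.
Qed.

Lemma copies_gt0 Z v f : (0 < copies Z v f)%N = caches Z v f.
Proof.
apply/card_gt0P/existsP => [[j]|[j fj]]; first by rewrite inE; exists j.
by exists j; rewrite inE.
Qed.

Definition holders Z T f : {set V} := [set v in T | caches Z v f].

Lemma holders_le_hits Z T f : (#|holders Z T f| <= hits (block T) [set f] Z)%N.
Proof.
rewrite hits_copies -sum1_card [leqLHS]big_mkcond [leqRHS]big_mkcond /=.
by apply: leq_sum => v _; rewrite inE -copies_gt0; case: (v \in T) => //=; case: posnP.
Qed.

(** Passes from copies back to distinct holders, at the price of the maximal multiplicity [s]. *)
Lemma hits_le_holders Z T f s : (forall v, (copies Z v f <= s)%N) ->
  (hits (block T) [set f] Z <= s * #|holders Z T f|)%N.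
Proof.
move=> cs; rewrite hits_copies mulnC -sum_nat_const /holders [leqRHS]big_mkcond /=.
rewrite [leqLHS]big_mkcond; apply: leq_sum => v _; rewrite inE.
case: (v \in T) => //=; rewrite -copies_gt0; case: posnP => [->|] //.
Qed.

Lemma size_le_stored Z v s : (forall f, (copies Z v f <= s)%N) ->
  (M <= s * #|stored Z v|)%N.
Proof.
move=> cs; have -> : M = (\sum_f copies Z v f)%N.
  rewrite -[LHS]card_ord -sum1_card (partition_big (fun j => Z (v, j)) xpredT) //=.
  by apply: eq_bigr => f _; rewrite /copies -sum1_card; apply: eq_bigl => j; rewrite inE.
rewrite mulnC -sum_nat_const [leqRHS]big_mkcond; apply: leq_sum => f _; rewrite inE.
by rewrite -copies_gt0; case: posnP => [->|].
Qed.

Lemma stored_le_size Z v : (#|stored Z v| <= M)%N.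
Proof.
rewrite -[leqRHS](card_ord M) -cardsT; apply: leq_trans (leq_imset_card (fun j => Z (v, j)) [set: 'I_M]).
apply: subset_leq_card; apply/fintype.subsetP => f; rewrite inE => /existsP[j /eqP <-].
by apply/imsetP; exists j.
Qed.

End RandomPlacement.

(** * Balls in the torus *)

Section GraphDistance.

Local Open Scope nat_scope.

Variables (V : finType) (e : rel V).

Definition walk k u v := [exists p : k.-tuple V, path e u p && (last u p == v)].

Lemma walk0 u v : walk 0 u v = (u == v).
Proof.
apply/existsP/idP => [[p]|/eqP ->]; first by rewrite (tuple0 p).
by exists [tuple]; rewrite /= eqxx.
Qed.

Lemma walkSP k u v : reflect (exists2 w, walk k u w & e w v) (walk k.+1 u v).
Proof.
apply: (iffP existsP) => [[[p sp]] /=|[w /existsP[p /andP[ep /eqP lp]] wv]].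
  case/lastP: p sp => // p x; rewrite size_rcons eqSS => sp.
  rewrite rcons_path last_rcons => /andP[/andP[ep ex] /eqP <-].
  by exists (last u p) => //; apply/existsP; exists (Tuple sp); rewrite /= ep eqxx.
exists [tuple of rcons p v] => /=.
by rewrite rcons_path last_rcons ep lp wv eqxx.
Qed.

Lemma gdist_le k u v : walk k u v -> (gdist e u v <= k)%N.
Proof.
move=> w; rewrite leqNgt; apply/negP => lt.
have kV : (k < #|V|)%N.
  by apply: (leq_trans lt); rewrite -[leqRHS](size_iota 0 #|V|) find_size.
by have := before_find 0 lt; rewrite nth_iota // add0n -/(walk k u v) w.
Qed.

Lemma gdist_walk u v : (gdist e u v < #|V|)%N -> walk (gdist e u v) u v.
Proof.
move=> lt; have lt' : has (fun k => walk k u v) (iota 0 #|V|).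
  by rewrite has_find size_iota.
by have := nth_find 0 lt'; rewrite nth_iota.
Qed.

Hypothesis e_sym : symmetric e.

Lemma walk_sym k u v : walk k u v -> walk k v u.
Proof.
move=> /existsP[[p sp] /= /andP[ep /eqP lp]]; apply/existsP.
have sr : size (rev (belast u p)) == k by rewrite size_rev size_belast.
exists (Tuple sr); rewrite /= -{1}lp rev_path.
rewrite (eq_path (e' := e)) ?ep => [|x y]; last exact: e_sym.
case: p {sp ep sr} lp => /= [->|x p lp]; first by rewrite eqxx.
by rewrite rev_cons last_rcons eqxx.
Qed.

Lemma gdist_sym u v : gdist e u v = gdist e v u.
Proof.
by apply: eq_find => k; apply/idP/idP; exact: walk_sym.
Qed.

End GraphDistance.

Section Torus.

Local Open Scope nat_scope.

Variable m : nat.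
Implicit Types (i j : 'I_m) (u v : ('I_m * 'I_m)%type).

Lemma cycle_adj_sym : symmetric (@cycle_adj m).
Proof. by move=> i j; rewrite /cycle_adj orbC. Qed.

Lemma torus_adj_sym : symmetric (@torus_adj m).
Proof.
move=> u v; rewrite /torus_adj (cycle_adj_sym v.1) (cycle_adj_sym v.2).
by rewrite (eq_sym v.1) (eq_sym v.2).
Qed.

(* [j] is within [k] of [i] on the cycle; the offset [m.-1 * k] stands for
   [-k] modulo [m]. *)
Definition cyc_near k i j := exists2 a, (a <= 2 * k)%N & nat_of_ord j = ((i + m.-1 * k + a) %% m)%N.

Lemma cyc_near_same k i j : cyc_near k i j -> cyc_near k.+1 i j.
Proof.
move=> [a ak ej]; have m0 : (0 < m)%N by exact: leq_ltn_trans (leq0n i) (ltn_ord i).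
exists a.+1; first by rewrite mulnS; exact: leq_trans (leqnSn _).
rewrite ej; have -> : (i + m.-1 * k.+1 + a.+1 = i + m.-1 * k + a + m)%N.
  by rewrite mulnS; move: (prednK m0); lia.
by rewrite modnDr.
Qed.

Lemma cyc_near_adj k i j j' : cyc_near k i j -> cycle_adj j j' -> cyc_near k.+1 i j'.
Proof.
move=> [a ak ej]; have m0 : (0 < m)%N by exact: leq_ltn_trans (leq0n i) (ltn_ord i).
case/orP => /eqP e.
  exists a.+2; first by rewrite mulnS ltnS.
  rewrite e /= ej -addn1 modnDml.
  have -> : (i + m.-1 * k.+1 + a.+2 = i + m.-1 * k + a + 1 + m)%N.
    by rewrite mulnS; move: (prednK m0); lia.
  by rewrite modnDr.
exists a; first by rewrite mulnS (leq_trans ak) // leq_addl.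
have -> : (i + m.-1 * k.+1 + a = i + m.-1 * k + a + m.-1)%N by rewrite mulnS; lia.
rewrite -modnDml -ej e /= modnDml addSn -addnS prednK // modnDr modn_small //.
Qed.

Lemma walk_near k u v : walk (@torus_adj m) k u v ->
  cyc_near k u.1 v.1 /\ cyc_near k u.2 v.2.
Proof.
elim: k v => [|k IH] v.
  rewrite walk0 => /eqP ->.
  by split; exists 0%N => //; rewrite muln0 !addn0 modn_small.
move=> /walkSP[w /IH[w1 w2]] /orP[] /andP[/eqP e adj].
  by split; [rewrite -e; exact: cyc_near_same|exact: cyc_near_adj adj].
by split; [exact: cyc_near_adj adj|rewrite -e; exact: cyc_near_same].
Qed.

Definition torus_ball k u := [set v | (gdist (@torus_adj m) u v <= k)%N].

(** A vertex reached in at most [k] steps is determined by two cyclic offsets, each with [2 * k + 1]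
    possible values. *)
Lemma card_torus_ball_le k u : (k < m)%N -> (#|torus_ball k u| <= (2 * k + 1) ^ 2)%N.
Proof.
move=> km; have m0 : (0 < m)%N by exact: leq_ltn_trans km.
pose h (i : 'I_m) (a : 'I_(2 * k + 1)) : 'I_m :=
  Ordinal (ltn_pmod (i + m.-1 * k + a) m0).
pose hh (ab : 'I_(2 * k + 1) * 'I_(2 * k + 1)) := (h u.1 ab.1, h u.2 ab.2).
have -> : ((2 * k + 1) ^ 2 = #|[set: 'I_(2 * k + 1) * 'I_(2 * k + 1)]|)%N.
  by rewrite cardsT card_prod !card_ord mulnn.
apply: leq_trans (leq_imset_card hh _).
apply: subset_leq_card; apply/fintype.subsetP => v; rewrite inE => dv.
(* This excludes the default value of [gdist] for unreachable vertices, so the distance comes from a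
   walk. *)
have cV : (k < #|{: 'I_m * 'I_m}|)%N.
  by rewrite card_prod !card_ord (leq_trans km) // leq_pmulr.
have := gdist_walk (leq_ltn_trans dv cV) => /walk_near[].
have near_mono i j d : (d <= k)%N -> cyc_near d i j -> cyc_near k i j.
  by move=> /subnKC <-; elim: (k - d)%N => [|x IH]; rewrite ?addn0 // addnS => /IH /cyc_near_same.
move=> /(near_mono _ _ _ dv)[a ak ea] /(near_mono _ _ _ dv)[b bk eb].
have a' : (a < 2 * k + 1)%N by rewrite addn1 ltnS.
have b' : (b < 2 * k + 1)%N by rewrite addn1 ltnS.
apply/imsetP; exists (Ordinal a', Ordinal b') => //.
by case: v {dv} ea eb => v1 v2 /= ea eb; congr (_, _); apply: val_inj.
Qed.

(** Moving forward by at most [k./2] in each coordinate costs at most [k] steps, and these moves end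
    at distinct vertices because [k./2 < m]. *)
Lemma card_torus_ball_ge k u : (k < m)%N -> ((k./2).+1 ^ 2 <= #|torus_ball k u|)%N.
Proof.
move=> km; have m0 : (0 < m)%N by exact: leq_ltn_trans km.
pose h (i : 'I_m) a : 'I_m := Ordinal (ltn_pmod (i + a) m0).
have h_adj i a : cycle_adj (h i a) (h i a.+1).
  rewrite /cycle_adj; apply/orP; left; apply/eqP/val_inj => /=.
  by rewrite -[in RHS]addn1 modnDml addn1 addnS.
have h0 i : h i 0 = i by apply: val_inj; rewrite /= addn0 modn_small.
have wh a b : walk (@torus_adj m) (a + b) u (h u.1 a, h u.2 b).
  elim: a => [|a IHa].
    rewrite h0; elim: b => [|b IHb]; first by rewrite h0 walk0; case: (u).
    by apply/walkSP; exists (u.1, h u.2 b) => //; rewrite /torus_adj /= eqxx h_adj.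
  by apply/walkSP; exists (h u.1 a, h u.2 b) => //; rewrite /torus_adj /= eqxx h_adj orbT.
pose hh (ab : 'I_(k./2).+1 * 'I_(k./2).+1) := (h u.1 ab.1, h u.2 ab.2).
have km2 : (k./2 < m)%N by rewrite (leq_ltn_trans _ km) // -[leqRHS](odd_double_half k) -addnn addnA leq_addl.
have h_inj i (a b : 'I_(k./2).+1) : h i a = h i b -> a = b.
  move=> /(congr1 val) /= /eqP; rewrite eqn_modDl => /eqP.
  by rewrite !modn_small ?(leq_trans (ltn_ord _)) // => e; exact: val_inj.
have hh_inj : injective hh.
  move=> [a b] [a' b'] [e1 e2]; congr (_, _).
    by apply: (h_inj u.1); exact: val_inj.
  by apply: (h_inj u.2); exact: val_inj.
have -> : ((k./2).+1 ^ 2 = #|hh @: [set: 'I_(k./2).+1 * 'I_(k./2).+1]|)%N.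
  by rewrite card_imset // cardsT card_prod !card_ord mulnn.
apply: subset_leq_card; apply/fintype.subsetP => _ /imsetP[[a b] _ ->].
rewrite inE; apply: leq_trans (gdist_le (wh a b)) _.
have : (a + b <= k./2 + k./2)%N by apply: leq_add; rewrite -ltnS.
by move=> /leq_trans; apply; rewrite addnn -[leqRHS](odd_double_half k) leq_addl.
Qed.

End Torus.

(** * Requests for a fixed placement *)

Lemma unif_ge0 {R : realType} (X : finType) (S : {set X}) x : 0 <= unif S x :> R.
Proof. by rewrite /unif divr_ge0. Qed.

Lemma sum_unif {R : realType} (X : finType) (S : {set X}) (h : X -> R) :
  \sum_x unif S x * h x = (\sum_(x in S) h x) / #|S|%:R.
Proof.
rewrite [in RHS]big_mkcond mulr_suml; apply: eq_bigr => x _; rewrite /unif.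
by case: (x \in S); rewrite ?mul0r // mul1r mulrC.
Qed.

Lemma sum_unif1 {R : realType} (X : finType) (S : {set X}) : (0 < #|S|)%N ->
  \sum_x unif S x = 1 :> R.
Proof.
move=> S0; have := @sum_unif R X S (fun=> 1); under eq_bigr do rewrite mulr1.
by move=> ->; rewrite sumr_const mulfV // pnatr_eq0 -lt0n.
Qed.

Lemma sum_indicator {R : realType} (X : finType) (S : {set X}) :
  \sum_x (x \in S)%:R = #|S|%:R :> R.
Proof. by rewrite -natr_sum -sum1_card [in RHS]big_mkcond. Qed.

Section Runs.

Context (V : finType) (e : rel V) (K : nat).
Implicit Types (l : V -> nat) (qs : seq (request V K)).

(** Each hop count depends on the current loads, so loads and accumulated hops run as one chain. *)
Definition cost_step (x : (V -> nat) * nat) (q : request V K) : (V -> nat) * nat :=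
  (step x.1 q, (x.2 + gdist e (origin q) (serve x.1 q))%N).

Lemma count_servers l qs i :
  (count_mem i (serve_seq l qs) + l i)%N = foldl (@step V K) l qs i.
Proof.
elim: qs l => [|q qs IH] l //=.
rewrite -IH /step (eq_sym i); move: (count_mem i _) (nat_of_bool _) (l i) => x y z; lia.
Qed.

Lemma foldl_cost_step l c qs :
  foldl (cost_step) (l, c) qs =
  (foldl (@step V K) l qs,
   (c + \sum_(x <- zip qs (serve_seq l qs)) gdist e (origin x.1) x.2)%N).
Proof.
elim: qs l c => [|q qs IH] l c /=; first by rewrite big_nil addn0.
by rewrite IH big_cons addnA.
Qed.

End Runs.

Section FixedPlacement.

Context {R : realType} (V : finType) (e : rel V) (K M : nat) (r : R).
Variable Z : placement V K M.
Hypothesis V_gt0 : (0 < #|V|)%N.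
Hypothesis K_gt0 : (0 < K)%N.
Hypothesis e_sym : symmetric e.

Local Notation cand := (candidates e r Z).
Local Notation pairs := (choice_pairs e r Z).
Local Notation pr := (request_pr e (@unif_popularity R K) r Z).
Local Notation N := #|V|.

Let N0 : 0 < N%:R :> R. Proof. by rewrite ltr0n. Qed.
Let K0 : 0 < K%:R :> R. Proof. by rewrite ltr0n. Qed.

Lemma request_pr_ge0 q : 0 <= pr q.
Proof. by rewrite /request_pr !mulr_ge0 ?unif_ge0 // invr_ge0. Qed.

Lemma sum_requests (h : V -> 'I_K -> V * V -> bool -> R) :
  \sum_q pr q * h (origin q) (file q) (choices q) (coin q) =
  (N%:R * K%:R)^-1 * \sum_u \sum_f \sum_vw unif (pairs u f) vw * ((h u f vw true + h u f vw false) / 2).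
Proof.
rewrite -(pair_bigA _ (fun x b => pr (x, b) * h x.1.1 x.1.2 x.2 b)) /=.
rewrite -(pair_bigA _ (fun x vw => \sum_b pr (x, vw, b) * h x.1 x.2 vw b)) /=.
rewrite -(pair_bigA _ (fun u f => \sum_vw \sum_b pr (u, f, vw, b) * h u f vw b)) /=.
rewrite mulr_sumr; apply: eq_bigr => u _; rewrite mulr_sumr; apply: eq_bigr => f _.
rewrite mulr_sumr; apply: eq_bigr => vw _.
rewrite big_bool /request_pr /unif /= !inE !cardsT card_bool /unif_popularity invfM.
by rewrite /origin /file /choices /=; ring.
Qed.

(** The fallback pair covers the case of fewer than two candidates, so [request_pr] is a probability
    for every placement. *)
Lemma pairs_gt0 u f : (0 < #|pairs u f|)%N.
Proof.
rewrite /choice_pairs; case: ifP => [A1|_]; last by rewrite cards1.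
have [v [w [vA wA vw]]] := card_gt1P A1.
by apply/card_gt0P; exists (v, w); rewrite !inE /=; move: vA wA; rewrite !inE => -> ->.
Qed.

Lemma request_pr_sum : \sum_q pr q = 1.
Proof.
have := sum_requests (fun _ _ _ _ => 1); under eq_bigr do rewrite mulr1.
have h2 : (1 + 1) / 2 = 1 :> R by lra.
move=> ->; under eq_bigr do under eq_bigr do under eq_bigr do rewrite h2 mulr1.
under eq_bigr do under eq_bigr do rewrite sum_unif1 ?pairs_gt0 //.
rewrite !sumr_const card_ord -mulrnA -[_ *+ (_ * _)]/(_%:R) natrM.
by rewrite [K%:R * _]mulrC mulVf // mulf_neq0 // gt_eqF.
Qed.

(** The matrix [a] of the two-choice process: the factor [N] cancels the uniform law of the
    origin. *)
Definition pair_weight v w : R :=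
  K%:R^-1 * \sum_u \sum_f unif (pairs u f) (v, w).

Lemma pair_weight_ge0 v w : 0 <= pair_weight v w.
Proof.
rewrite mulr_ge0 ?invr_ge0 //; apply: sumr_ge0 => u _; apply: sumr_ge0 => f _.
exact: unif_ge0.
Qed.

Lemma pair_weight_law (h : V -> V -> bool -> R) :
  \sum_q pr q * h (choices q).1 (choices q).2 (coin q) =
  N%:R^-1 * \sum_v \sum_w pair_weight v w * ((h v w true + h v w false) / 2).
Proof.
rewrite (sum_requests (fun _ _ vw b => h vw.1 vw.2 b)) invfM -mulrA; congr (_ * _).
rewrite (pair_bigA _ (fun v w => pair_weight v w * ((h v w true + h v w false) / 2))) /=.
under eq_bigr do rewrite exchange_big.
rewrite exchange_big /= mulr_sumr; apply: eq_bigr => -[v w] _ /=.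
rewrite /pair_weight -mulrA mulr_suml; congr (_ * _); apply: eq_bigr => u _.
by rewrite mulr_suml.
Qed.

Hypothesis cand2 : forall u f, (1 < #|cand u f|)%N.

Lemma in_pairs u f v w : ((v, w) \in pairs u f) = [&& v \in cand u f, w \in cand u f & v != w].
Proof. by rewrite /choice_pairs cand2 inE finset.in_setX /= andbA. Qed.

Lemma card_pairs u f : #|pairs u f| = (#|cand u f| * #|cand u f|.-1)%N.
Proof.
rewrite -sum1_card (eq_bigl (fun vw => (vw.1 \in cand u f) && ((vw.2 \in cand u f) && (vw.1 != vw.2)))); last first.
  by case=> v w; rewrite in_pairs.
rewrite -(pair_big_dep (mem (cand u f)) (fun v w => (w \in cand u f) && (v != w)) (fun _ _ => 1%N)) /=.
rewrite -sum_nat_const; apply: eq_bigr => v vA.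
rewrite (cardsD1 v (cand u f)) vA add1n /= -sum1_card; apply: eq_bigl => w.
by rewrite in_setD1 andbC eq_sym.
Qed.

Lemma pair_weight_sym v w : pair_weight v w = pair_weight w v.
Proof.
rewrite /pair_weight; congr (_ * _); apply: eq_bigr => u _; apply: eq_bigr => f _.
rewrite /unif !in_pairs; congr (_%:R / _); rewrite eq_sym.
by case: (v \in _); case: (w \in _).
Qed.

(** Every candidate is the first entry of equally many pairs, so the first choice alone is uniform
    among the candidates. *)
Lemma sum_unif_pairs_fst u f (h : V -> R) :
  \sum_vw unif (pairs u f) vw * h vw.1 = (\sum_(v in cand u f) h v) / #|cand u f|%:R.
Proof.
rewrite sum_unif (eq_bigl (fun vw => (vw.1 \in cand u f) && ((vw.2 \in cand u f) && (vw.1 != vw.2)))); last first.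
  by case=> v w; rewrite in_pairs.
rewrite -(pair_big_dep (mem (cand u f)) (fun v w => (w \in cand u f) && (v != w)) (fun v _ => h v)) /=.
rewrite card_pairs natrM invfM mulrA [in RHS]mulr_suml mulr_suml mulr_suml.
apply: eq_bigr => v vA; rewrite sumr_const.
rewrite (_ : #|_| = #|cand u f|.-1).
  rewrite -[h v *+ _]mulr_natr; field.
  by rewrite !pnatr_eq0; have := cand2 u f; case: #|_| => [|[]].
rewrite (cardsD1 v (cand u f)) vA add1n /=; apply: eq_card => w.
by rewrite in_setD1 andbC eq_sym.
Qed.

Lemma sum_unif_pairs_snd u f (h : V -> R) :
  \sum_vw unif (pairs u f) vw * h vw.2 = (\sum_(v in cand u f) h v) / #|cand u f|%:R.
Proof.
rewrite -sum_unif_pairs_fst (reindex (fun vw : V * V => (vw.2, vw.1))) /=.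
  apply: eq_bigr => -[v w] _ /=; congr (_ * _); rewrite /unif !in_pairs; congr (_%:R / _).
  by rewrite eq_sym; case: (v \in _); case: (w \in _).
by exists (fun vw : V * V => (vw.2, vw.1)) => -[].
Qed.

Lemma candE u f v : (v \in cand u f) = (u \in ball_of e r v) && (f \in stored Z v).
Proof. by rewrite !inE gdist_sym. Qed.

Lemma sum_pair_weight v :
  \sum_w pair_weight v w =
  K%:R^-1 * \sum_(u in ball_of e r v) \sum_(f in stored Z v) #|cand u f|%:R^-1.
Proof.
rewrite /pair_weight -mulr_sumr; congr (_ * _).
rewrite exchange_big [RHS]big_mkcond; apply: eq_bigr => u _ /=.
rewrite exchange_big /= -[RHS](_ : \sum_f (v \in cand u f)%:R / #|cand u f|%:R = _); last first.
  case uv : (u \in ball_of e r v).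
    by rewrite [RHS]big_mkcond; apply: eq_bigr => f _; rewrite candE uv /=; case: (_ \in _); rewrite ?mul1r ?mul0r.
  by rewrite big1 // => f _; rewrite candE uv mul0r.
apply: eq_bigr => f _.
have := sum_unif_pairs_fst u f (fun x => (x == v)%:R).
rewrite (eq_bigr (fun x => unif (pairs u f) (x.1, x.2) * (x.1 == v)%:R)); last by case.
rewrite -(pair_bigA _ (fun x w => unif (pairs u f) (x, w) * (x == v)%:R)) /=.
rewrite (bigD1 v) //= [X in _ + X]big1 ?addr0 => [|x /negPf xv]; last first.
  by rewrite big1 // => w _; rewrite xv mulr0.
under eq_bigr do rewrite eqxx mulr1.
move=> ->; congr (_ / _); case: (boolP (v \in cand u f)) => vA.
  by rewrite (bigD1 v) //= eqxx big1 ?addr0 // => x /andP[_ /negPf ->].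
by rewrite big1 // => x xA; case: eqP => // xv; move: vA; rewrite -xv xA.
Qed.

Variables (LA UA bl bu tau s : R).
Hypothesis LA0 : 0 < LA.
Hypothesis cand_bounds : forall u f, LA <= #|cand u f|%:R <= UA.
Hypothesis ball_bounds : forall u, bl <= #|ball_of e r u|%:R <= bu.
Hypothesis bl0 : 0 <= bl.
Hypothesis shared_bound : forall v w, v != w -> #|stored Z v :&: stored Z w|%:R <= tau.
Hypothesis s0 : 0 < s.
Hypothesis stored_bound : forall v, M%:R <= s * #|stored Z v|%:R.

(** Only origins in the ball around [v] and files shared by [v] and [w] contribute, each at most
    [2 / LA ^+ 2]. The diagonal vanishes because choices are distinct. *)
Lemma pair_weight_le v w : 0 <= tau -> pair_weight v w <= 2 * bu * tau / (K%:R * LA ^+ 2).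
Proof.
move=> tau0.
have bu0 : 0 <= bu by have /andP[_] := ball_bounds v; apply: le_trans.
case: (eqVneq v w) => [<-|vw].
  rewrite /pair_weight big1 ?mulr0 => [|u _].
    by rewrite divr_ge0 ?mulr_ge0 ?exprn_ge0 ?(ltW LA0).
  by rewrite big1 // => f _; rewrite /unif in_pairs eqxx !andbF mul0r.
have b u f : unif (pairs u f) (v, w) <=
    (u \in ball_of e r v)%:R * (f \in stored Z v :&: stored Z w)%:R * (2 / LA ^+ 2) :> R.
  rewrite /unif in_pairs !candE finset.in_setI vw andbT.
  case: (u \in ball_of e r v) => /=; last by rewrite !mul0r.
  case: (f \in stored Z v) => /=; last by rewrite !mulr0 !mul0r.
  case: (f \in stored Z w); rewrite ?andbF ?mulr0 ?mul0r // andbT.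
  case: (u \in _); rewrite !mul1r ?mul0r; last by rewrite divr_ge0 // exprn_ge0 // ltW.
  rewrite card_pairs natrM -div1r ler_pdivrMr; last first.
    by rewrite -natrM ltr0n muln_gt0; have := cand2 u f; case: #|_| => [|[]].
  have -> : (#|cand u f|.-1%:R = #|cand u f|%:R - 1 :> R).
    by rewrite -subn1 natrB // ltnW.
  have c2 : 2 <= #|cand u f|%:R :> R by rewrite ler_nat.
  have /andP[cL _] := cand_bounds u f.
  rewrite mulrAC ler_pdivlMr ?exprn_gt0 // mul1r.
  have LA2 : LA ^+ 2 <= #|cand u f|%:R ^+ 2.
    by rewrite lerXn2r // nnegrE ?ler0n ?(ltW LA0).
  by apply: (le_trans LA2); move: c2; move: (#|_|%:R) => x; nra.
rewrite /pair_weight invfM mulrCA ler_pM2l ?invr_gt0 //.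
apply: (@le_trans _ _ (\sum_u \sum_f (u \in ball_of e r v)%:R * (f \in stored Z v :&: stored Z w)%:R * (2 / LA ^+ 2))).
  by apply: ler_sum => u _; apply: ler_sum => f _.
under eq_bigr do rewrite -mulr_suml -mulr_sumr sum_indicator.
rewrite -!mulr_suml sum_indicator.
have /andP[_ bv] := ball_bounds v; have sv := shared_bound vw.
rewrite (_ : 2 * bu * tau * _ = bu * tau * (2 / LA ^+ 2)); last by ring.
by rewrite ler_wpM2r ?divr_ge0 ?exprn_ge0 ?(ltW LA0) // ler_pM.
Qed.

(** Counts the origins and files that have [v] as a candidate: ball size times number of stored
    files, each weighted by an inverse candidate count. *)
Lemma sum_pair_weight_bounds v :
  bl * M%:R / (K%:R * s * UA) <= \sum_w pair_weight v w <= bu * M%:R / (K%:R * LA).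
Proof.
rewrite sum_pair_weight; have /andP[b1 b2] := ball_bounds v.
have UA0 : 0 < UA by have /andP[h1 h2] := cand_bounds v (Ordinal K_gt0); exact: lt_le_trans LA0 (le_trans h1 h2).
have sb := stored_bound v.
have sM : #|stored Z v|%:R <= M%:R :> R by rewrite ler_nat stored_le_size.
have cst (c : R) : \sum_(u in ball_of e r v) \sum_(f in stored Z v) c =
    #|ball_of e r v|%:R * #|stored Z v|%:R * c.
  by rewrite !sumr_const -mulrnA mulnC -[LHS]mulr_natl natrM.
have Kne : K%:R != 0 :> R by rewrite gt_eqF.
apply/andP; split.
  apply: (@le_trans _ _ (K%:R^-1 * \sum_(u in ball_of e r v) \sum_(f in stored Z v) UA^-1)).
    rewrite cst ler_pdivrMr ?mulr_gt0 //.
    rewrite (_ : _ * (K%:R * s * UA) = #|ball_of e r v|%:R * (s * #|stored Z v|%:R)).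
      by apply: ler_pM.
    by field; rewrite Kne gt_eqF.
  rewrite ler_pM2l ?invr_gt0 //; apply: ler_sum => u _; apply: ler_sum => f _.
  have /andP[h1 h2] := cand_bounds u f.
  by rewrite lef_pV2 ?posrE //; apply: lt_le_trans h1.
apply: (@le_trans _ _ (K%:R^-1 * \sum_(u in ball_of e r v) \sum_(f in stored Z v) LA^-1)).
  rewrite ler_pM2l ?invr_gt0 //; apply: ler_sum => u _; apply: ler_sum => f _.
  have /andP[h1 h2] := cand_bounds u f.
  by rewrite lef_pV2 ?posrE //; apply: lt_le_trans h1.
rewrite cst ler_pdivlMr ?mulr_gt0 //.
rewrite (_ : _ * (K%:R * LA) = #|ball_of e r v|%:R * #|stored Z v|%:R).
  by apply: ler_pM.
by field; rewrite Kne gt_eqF.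
Qed.

(** * Communication cost and failure of a run *)

Variable rho : R.
Hypothesis rho0 : 0 < rho.
Local Notation near u := (ball_of e rho u).
Hypothesis near_bound : forall u f, 8 * #|holders Z (near u) f|%:R <= #|cand u f|%:R :> R.

(** The server is near only if one of the choices is, and each is near with probability at most
    [1 / 8]. Far servers contribute at most [expR (- 1) <= 1 / 2], whence
    [1 / 2 + (1 / 2) * (1 / 4)]. *)
Lemma cost_drift l : \sum_q pr q * expR (- ((gdist e (origin q) (serve l q))%:R / rho)) <= 5 / 8.
Proof.
pose nr u v : R := (v \in near u)%:R.
apply: (@le_trans _ _ (\sum_q pr q * (1 / 2 + 1 / 2 *
   (nr (origin q) (choices q).1 + nr (origin q) (choices q).2)))).
  apply: ler_sum => q _; rewrite ler_wpM2l ?request_pr_ge0 //.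
  have nr0 v : 0 <= nr (origin q) v by [].
  have e1 : forall v, expR (- ((gdist e (origin q) v)%:R / rho)) <= 1.
    by move=> v; rewrite expR_le1 oppr_le0 divr_ge0 // ltW.
  have e2 v : expR (- ((gdist e (origin q) v)%:R / rho)) <= 1 / 2 + 1 / 2 * nr (origin q) v.
    rewrite /nr inE; case: (leP (gdist e (origin q) v)%:R rho) => [_|far].
      by apply: (le_trans (e1 v)); rewrite /= mulr1n; lra.
    rewrite /= mulr0n mulr0 addr0.
    apply: (@le_trans _ _ (expR (- 1))).
      by rewrite ler_expR lerN2 ler_pdivlMr // mul1r ltW.
    by have := @expRN_le1Bhalf R 1; rewrite lexx ler01 => /(_ isT); lra.
  have [] : serve l q = (choices q).1 \/ serve l q = (choices q).2.
  - by rewrite serveE; exact: server_or.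
  - by move=> ->; have := e2 (choices q).1; have := nr0 (choices q).2; lra.
  - by move=> ->; have := e2 (choices q).2; have := nr0 (choices q).1; lra.
rewrite (sum_requests (fun u f vw b => 1 / 2 + 1 / 2 * (nr u vw.1 + nr u vw.2))).
rewrite invfM -mulrA ler_pdivrMl //.
have H u f : \sum_vw unif (pairs u f) vw *
    ((1 / 2 + 1 / 2 * (nr u vw.1 + nr u vw.2) + (1 / 2 + 1 / 2 * (nr u vw.1 + nr u vw.2))) / 2) <= 5 / 8.
  pose x v : R := 1 / 4 + 1 / 2 * nr u v.
  rewrite (eq_bigr (fun vw => unif (pairs u f) vw * x vw.1 + unif (pairs u f) vw * x vw.2)); last first.
    by move=> vw _; rewrite /x; lra.
  rewrite big_split /= sum_unif_pairs_fst sum_unif_pairs_snd.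
  rewrite -mulrDl ler_pdivrMr ?ltr0n; last by rewrite ltnW.
  rewrite /x big_split /= sumr_const -mulr_sumr.
  have -> : \sum_(v in cand u f) nr u v = #|holders Z (near u) f :&: cand u f|%:R.
    rewrite -sum_indicator [LHS]big_mkcond; apply: eq_bigr => v _.
    rewrite /nr !inE; case: (_ <= rho) => /=; case: (_ <= r) => //=; by case: caches.
  have : #|holders Z (near u) f :&: cand u f|%:R <= #|holders Z (near u) f|%:R :> R.
    by rewrite ler_nat; apply: subset_leq_card; exact: finset.subsetIl.
  by have := near_bound u f; rewrite -mulr_natl; lra.
apply: (@le_trans _ _ (K%:R^-1 * (\sum_(u : V) \sum_(f < K) 5 / 8))).
  rewrite ler_pM2l ?invr_gt0 //; apply: ler_sum => u _; apply: ler_sum => f _; exact: H.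
have cstK : \sum_(f < K) (5 / 8) = K%:R * (5 / 8) :> R.
  by rewrite sumr_const card_ord [RHS]mulr_natl.
have cstV (c : R) : \sum_(u : V) c = N%:R * c by rewrite sumr_const [RHS]mulr_natl.
by rewrite cstK cstV mulrCA mulKf ?gt_eqF.
Qed.

(** Since [5 / 8 <= expR (- (3 / 8))], the exponent per request is [1 / 4 - 3 / 8 = - 1 / 8]. *)
Lemma cost_tail :
  chainE pr (@cost_step V e K) N (fun x => (x.2%:R < rho * N%:R / 4)%R%:R) (fun=> 0%N, 0%N)
  <= expR (- (N%:R / 8)).
Proof.
have p0 := request_pr_ge0.
pose phi (x : (V -> nat) * nat) := expR (- (x.2%:R / rho)).
apply: (@le_trans _ _ (chainE pr (@cost_step V e K) N (fun x => expR (N%:R / 4) * phi x) (fun=> 0%N, 0%N))).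
  apply: (@chainE_le _ _ _ _ _ p0 (fun=> True)) => // x _.
  apply: ler_indicator => [|h]; first by rewrite mulr_ge0 ?expR_ge0.
  rewrite /phi -expRD -[X in X <= _]expR0 ler_expR subr_ge0 ler_pdivrMr //.
  by rewrite mulrC mulrA ltW.
rewrite chainEZ.
have drift : chainE pr (@cost_step V e K) N phi (fun=> 0%N, 0%N) <= expR (- (3 / 8)) ^+ N * phi (fun=> 0%N, 0%N).
  apply: (@chainE_drift _ _ _ _ _ p0 (fun=> True)) => // [[l c] _].
  rewrite /phi /=.
  under eq_bigr do rewrite natrD mulrDl opprD expRD mulrCA.
  rewrite -mulr_sumr mulrC ler_wpM2r ?expR_ge0 //.
  apply: (le_trans (cost_drift l)); apply: (le_trans _ (expR_ge1Dx _)); lra.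
apply: (@le_trans _ _ (expR (N%:R / 4) * expR (- (3 / 8)) ^+ N)).
  rewrite ler_pM2l ?expR_gt0 //; apply: (le_trans drift).
  by rewrite /phi /= mul0r oppr0 expR0 mulr1.
by rewrite -expRM_natl -expRD ler_expR; lra.
Qed.



Lemma gdist_serve l q : pr q != 0 -> (gdist e (origin q) (serve l q))%:R <= r.
Proof.
rewrite /request_pr => prq; have : choices q \in pairs (origin q) (file q).
  by apply: contraR prq => /negPf nin; rewrite /unif nin mul0r mulr0 mul0r.
rewrite [choices q]surjective_pairing in_pairs !inE.
move=> /and3P[/andP[d1 _] /andP[d2 _] _].
by rewrite serveE; case: (server_or l (choices q).1 (choices q).2 (coin q)) => ->.
Qed.

Lemma sum_gdist_le l qs : {in qs, forall q, pr q != 0} ->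
  (\sum_(x <- zip qs (serve_seq l qs)) gdist e (origin x.1) x.2)%:R <= r * (size qs)%:R.
Proof.
elim: qs l => [|q qs IH] l prq /=; first by rewrite big_nil mulr0.
rewrite big_cons natrD mulrS mulrDr mulr1; apply: lerD.
  by apply: gdist_serve; apply: prq; rewrite mem_head.
by apply: IH => q' q'qs; apply: prq; rewrite in_cons q'qs orbT.
Qed.

Lemma run_failure theta c0 C0 d j0 i k kl nl n :
  #|V| = n -> 0 <= tau -> 0 <= theta ->
  theta * (2 * bu * tau / (K%:R * LA ^+ 2)) <= 2^-1 ->
  0 < c0 <= 1 -> c0 <= bl * M%:R / (K%:R * s * UA) ->
  1 <= C0 -> bu * M%:R / (K%:R * LA) <= C0 ->
  0 < d <= 8^-1 -> 128 * C0 ^+ 2 <= j0%:R ->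
  (0 < kl)%N -> (kl * nl <= n <= 2 * kl * nl)%N ->
  \sum_(qs : n.-tuple (request V K)) (\prod_(q <- qs) pr q) *
    (~~ ((kl <= max_load (Z, qs) < j0 + i + k)%N &&
         (rho / 4 <= comm_cost e (Z, qs) <= r)))%:R
  <= n%:R * (i.+1%:R * expR (- (theta * d / 2))
       + expR 2 * Num.max (2^-1 ^+ (2 ^ i) / 8) d ^+ k)
   + kl%:R * (n%:R * expR (- (theta * (32 * kl%:R * (c0 / (32 * kl%:R)) ^+ (2 ^ kl)))))
   + expR (- (n%:R / 8)).
Proof.
move=> <- tau0 th0 thw c01 c0le C1 C0ge d01 j0ge kl0 klnl.
have p0 := request_pr_ge0; have p1 := request_pr_sum.
have tha v w : theta * pair_weight v w <= 2^-1.
  by apply: le_trans thw; rewrite ler_wpM2l // pair_weight_le.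
have sumC v : \sum_w pair_weight v w <= C0.
  by have /andP[_ /le_trans] := sum_pair_weight_bounds v; apply.
have sumc v : c0 <= \sum_w pair_weight v w.
  by have /andP[/(le_trans c0le)] := sum_pair_weight_bounds v.
have up := @max_load_tail _ _ _ _ _ _ V_gt0 p0 p1 pair_weight_ge0 pair_weight_sym
  pair_weight_law theta C0 d j0 i k th0 C1 d01 tha sumC j0ge.
have low := @low_load_tail _ _ _ _ _ _ V_gt0 p0 p1 pair_weight_ge0
  pair_weight_law theta c0 kl nl th0 c01 V_gt0 tha sumc kl0 klnl.
apply: le_trans _ (lerD (lerD up low) cost_tail).
rewrite -!chainE_foldl -!big_split /=; apply: ler_sum => qs _.
(* Sequences of probability zero are discarded; in the others all choices are candidates, so the
   cost is at most [r] with certainty. *)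
rewrite -!mulrDr; have [->|pqs] := eqVneq (\prod_(q <- qs) pr q) 0; first by rewrite !mul0r.
rewrite ler_wpM2l ?prodr_ge0 //.
have qs0 : {in qs, forall q, pr q != 0}.
  by move=> q qqs; apply: contraNneq pqs => pq0; rewrite prodf_seq_eq0; apply/hasP; exists q; rewrite //= pq0.
rewrite foldl_cost_step /= add0n.
set l := foldl _ _ _; set c := \sum_(x <- _) _.
have cnt v : count_mem v (servers (Z, qs)) = l v.
  by rewrite -[LHS]addn0 (count_servers (fun=> 0%N)).
have cr : c%:R <= r * N%:R by rewrite -{1}(size_tuple qs); exact: sum_gdist_le.
apply: ler_indicator => [|fail]; first by rewrite !addr_ge0.
case: (boolP [exists v, _]) => [_|/existsPn hi]; first by rewrite -addrA lerDl addr_ge0.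
case: (boolP [forall w, _]) => [_|/forallPn[w lo]]; first by rewrite add0r lerDl.
rewrite !add0r; case: (ltP c%:R) => //= cl; move: fail.
have -> : (kl <= max_load (Z, qs) < j0 + i + k)%N.
  apply/andP; split.
    by apply: leq_trans (leq_bigmax w); rewrite cnt leqNgt.
  have j00 : (0 < j0 + i + k)%N by apply: leq_ltn_trans (leq0n (l w)) _; rewrite ltnNge.
  rewrite -(prednK j00) ltnS; apply/bigmax_leqP => v _; rewrite cnt -ltnS prednK //.
  by rewrite ltnNge.
rewrite /comm_cost -/c ler_pdivlMr // ler_pdivrMr // cr.
by rewrite mulrAC cl.
Qed.

End FixedPlacement.

(** Conditioning on the placement: a bad one is charged its full probability, a good one the failure
    bound [t]. *)
Lemma Pr_ge {R : realType} (V : finType) (e : rel V) (K M N : nat) (r t : R)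
    (good : pred (placement V K M)) (E : pred (outcome V K M N)) :
  (0 < #|V|)%N -> (0 < K)%N -> 0 <= t ->
  (forall Z, good Z -> \sum_(qs : N.-tuple (request V K))
     (\prod_(q <- qs) request_pr e (@unif_popularity R K) r Z q) * (~~ E (Z, qs))%:R <= t) ->
  1 - (drawE (fun Z => (~~ good Z)%:R) + t) <= Pr e (@unif_popularity R K) r E.
Proof.
move=> V0 K0 t0 bad; rewrite lerBlDr.
pose pq (Z : placement V K M) (qs : N.-tuple (request V K)) := \prod_(q <- qs) request_pr e (@unif_popularity R K) r Z q.
have tot Z : \sum_qs pq Z qs = 1.
  have := chainE_foldl (request_pr e (@unif_popularity R K) r Z) (fun s _ => s) N (fun=> 1) tt.
  under eq_bigr do rewrite mulr1.
  by rewrite chainE_cst //; exact: request_pr_sum.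
have -> : Pr e (@unif_popularity R K) r E = drawE (fun Z => \sum_qs pq Z qs * (E (Z, qs))%:R).
  rewrite /Pr big_mkcond /drawE.
  under [RHS]eq_bigr do rewrite mulr_sumr.
  rewrite pair_bigA /=; apply: eq_bigr => -[Z qs] _ /=; rewrite /outcome_pr /=.
  by case: (E _); rewrite ?mulr1 // !mulr0.
rewrite -[leLHS](@drawE1 R (V * 'I_M)%type K K0).
have -> : t = drawE (fun _ : {ffun V * 'I_M -> 'I_K} => t).
  rewrite -[LHS]mulr1 -(@drawE1 R (V * 'I_M)%type K K0) -drawEZ.
  by apply: eq_bigr => Z _; rewrite mulr1.
rewrite /drawE -!big_split /=; apply: ler_sum => Z _.
rewrite -!mulrDr ler_wpM2l ?draw_pr_ge0 //.
have split1 : 1 = \sum_qs pq Z qs * (E (Z, qs))%:R + \sum_qs pq Z qs * (~~ E (Z, qs))%:R.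
  rewrite -big_split /= -[LHS](tot Z); apply: eq_bigr => qs _.
  by case: (E _); rewrite /= mulr1 mulr0 ?addr0 ?add0r.
rewrite [leLHS]split1 lerD2l; case: (boolP (good Z)) => gZ; first by rewrite add0r; exact: bad.
apply: (@le_trans _ _ 1); last by rewrite lerDl.
rewrite -[leRHS](tot Z); apply: ler_sum => qs _.
have pq0 : 0 <= pq Z qs by apply: prodr_ge0 => q _; exact: request_pr_ge0.
by case: (~~ _); rewrite ?mulr1 ?mulr0.
Qed.

(** * Typical placements *)

Lemma torus_ball_bounds {R : realType} m (r : R) u :
  1 <= r -> r < m%:R ->
  (r / 2) ^+ 2 <= #|ball_of (@torus_adj m) r u|%:R <= (3 * r) ^+ 2.
Proof.
move=> r1 rm; have r0 : 0 <= r by lra.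
have -> : ball_of (@torus_adj m) r u = torus_ball (Num.truncn r) u.
  by apply/setP => v; rewrite !inE truncn_ge_nat.
have km : (Num.truncn r < m)%N by rewrite truncn_lt_nat.
have /andP[kr rk] := truncn_itv r0.
set k := Num.truncn r in km kr rk *.
have k2 : k%:R + 1 <= 2 * (k./2).+1%:R :> R.
  by rewrite natr1 -natrM ler_nat; lia.
apply/andP; split.
  have : ((k./2).+1 ^ 2)%:R <= #|torus_ball k u|%:R :> R by rewrite ler_nat card_torus_ball_ge.
  apply: le_trans; rewrite natrX lerXn2r // ?nnegrE ?divr_ge0 //.
  by rewrite ler_pdivrMr //; move: rk k2; rewrite -natr1 => *; lra.
have : #|torus_ball k u|%:R <= ((2 * k + 1) ^ 2)%:R :> R by rewrite ler_nat card_torus_ball_le.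
move=> /le_trans; apply; rewrite natrX lerXn2r // ?nnegrE ?mulr_ge0 //.
by rewrite natrD natrM; lra.
Qed.

Lemma drawE_exists {R : realType} (I : finType) (K : nat) (J : finType)
    (P : J -> {ffun I -> 'I_K} -> bool) (b : R) :
  (forall j, drawE (fun Z => (P j Z)%:R) <= b) ->
  drawE (fun Z => [exists j, P j Z]%:R) <= #|J|%:R * b.
Proof.
move=> Pb; apply: (@le_trans _ _ (drawE (fun Z => \sum_j (P j Z)%:R))).
  apply: drawE_le => Z; apply: ler_indicator => [|/existsP[j Pj]]; first exact: sumr_ge0.
  by rewrite (bigD1 j) //= Pj lerDl sumr_ge0.
rewrite drawE_sum; apply: (@le_trans _ _ (\sum_(j : J) b)); first exact: ler_sum.
by rewrite sumr_const [leRHS]mulr_natl.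
Qed.

Section GoodPlacement.

Context {R : realType} (V : finType) (e : rel V) (K M : nat) (r rho lam y : R).
Hypothesis K_gt0 : (0 < K)%N.
Implicit Type Z : placement V K M.

Local Notation hits_ball t u f Z := (hits (block M (ball_of e t u)) [set f] Z)%:R.

(* [lam] is the order of the expected number of holders of a file within
   distance [r].  At most 9 copies per server turn [lam / 32] hits into
   [lam / 288] holders, and [lam / 48 ^ 2] is one eighth of that. *)
Definition many_copies Z :=
  [exists vf : V * 'I_K, (10 <= hits (block M [set vf.1]) [set vf.2] Z)%N].
Definition few_holders Z := [exists uf : V * 'I_K, hits_ball r uf.1 uf.2 Z <= lam / 32].
Definition many_holders Z := [exists uf : V * 'I_K, 20 * lam <= hits_ball r uf.1 uf.2 Z].
Definition many_near_holders Z :=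
  [exists uf : V * 'I_K, lam / 48 ^+ 2 <= hits_ball rho uf.1 uf.2 Z].
Definition many_shared Z :=
  [exists vw : V * V, (vw.1 != vw.2) &&
     (12 * y <= #|stored Z vw.1 :&: stored Z vw.2|%:R)].

Definition good Z : bool :=
  [&& ~~ many_copies Z, ~~ few_holders Z, ~~ many_holders Z,
      ~~ many_near_holders Z & ~~ many_shared Z].

Section GoodPlacementProperties.

Variables (Z : placement V K M) (gZ : good Z).

Lemma good_copies v f : (copies Z v f <= 9)%N.
Proof.
case/and5P: gZ => /existsPn /(_ (v, f)) /=.
by rewrite -ltnNge hits_copies big_set1.
Qed.

Lemma good_candidates u f : lam / 288 <= #|candidates e r Z u f|%:R <= 20 * lam.
Proof.
case/and5P: gZ => _ /existsPn /(_ (u, f)) /= h1 /existsPn /(_ (u, f)) /= h2 _ _.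
rewrite -!ltNge in h1 h2; apply/andP; split.
  have := hits_le_holders (ball_of e r u) (good_copies^~ f).
  rewrite -(ler_nat R) natrM; rewrite -/(holders _ _ _) in h1 *.
  rewrite -[candidates e r Z u f]/(holders Z (ball_of e r u) f); lra.
apply: le_trans (ltW h2); rewrite ler_nat; exact: holders_le_hits.
Qed.

Lemma good_near u f :
  8 * #|holders Z (ball_of e rho u) f|%:R <= #|candidates e r Z u f|%:R :> R.
Proof.
have /andP[h1 _] := good_candidates u f; apply: le_trans h1.
case/and5P: gZ => _ _ _ /existsPn /(_ (u, f)) /=; rewrite -ltNge => h _.
have := holders_le_hits Z (ball_of e rho u) f; rewrite -(ler_nat R) => h2.
by lra.
Qed.

Lemma good_shared v w : v != w -> #|stored Z v :&: stored Z w|%:R <= 12 * y.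
Proof.
move=> vw; case/and5P: gZ => _ _ _ _ /existsPn /(_ (v, w)) /=.
by rewrite vw /= -ltNge => /ltW.
Qed.

Lemma good_stored v : M%:R <= 9 * #|stored Z v|%:R :> R.
Proof. by rewrite -natrM ler_nat size_le_stored // => f; exact: good_copies. Qed.

End GoodPlacementProperties.

Hypothesis card_V : #|V| = K.
Hypothesis K_exp : K%:R = expR y.
Hypothesis y1 : 1 <= y.
Hypothesis M_gt0 : (0 < M)%N.
Hypothesis M_small : M%:R / K%:R <= expR (- (y / 2)).
Hypothesis ball_r : forall u, lam / 8 <= #|ball_of e r u|%:R * M%:R / K%:R <= 9 * lam.
Hypothesis ball_rho : forall u, #|ball_of e rho u|%:R * M%:R / K%:R <= lam / 100 ^+ 2.
Hypothesis lam_large : 4 * 100 ^+ 2 * y <= lam.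

(** Five union bounds, each over [K * K = expR (2 * y)] pairs of events of probability at most
    [expR (- (4 * y))]. *)
Lemma bad_placement : drawE (fun Z => (~~ good Z)%:R) <= 5 * expR (- (2 * y)).
Proof.
have y1' := y1; have lam_large' := lam_large.
have K0 : 0 < K%:R :> R by rewrite ltr0n.
have MK : (M <= K)%N.
  rewrite -(ler_nat R) -[leRHS]mul1r -ler_pdivrMr //; apply: (le_trans M_small).
  by rewrite expR_le1; lra.
have MMK : M%:R * M%:R / K%:R <= 1 :> R.
  have -> : M%:R * M%:R / K%:R = (M%:R / K%:R) ^+ 2 * K%:R :> R.
    by rewrite expr2; field; rewrite gt_eqF.
  rewrite K_exp -ler_pdivlMr ?expR_gt0 // -K_exp.
  apply: (@le_trans _ _ (expR (- (y / 2)) ^+ 2)).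
    by rewrite lerXn2r ?nnegrE ?expR_ge0 // divr_ge0.
  by rewrite -expRM_natl K_exp div1r -expRN ler_expR; lra.
have hb (T : {set V}) (f : 'I_K) :
    #|block M T|%:R * #|[set f]|%:R / K%:R = #|T|%:R * M%:R / K%:R :> R.
  by rewrite card_block cards1 mulr1 natrM.
have e2 (J : finType) (P : J -> placement V K M -> bool) : #|J| = (K * K)%N ->
    (forall j, drawE (fun Z => (P j Z)%:R) <= expR (- (4 * y))) ->
    drawE (fun Z => [exists j, P j Z]%:R) <= expR (- (2 * y)) :> R.
  move=> JK /drawE_exists /le_trans; apply.
  by rewrite JK natrM K_exp -!expRD ler_expR; lra.
have cVK : #|{: V * 'I_K}| = (K * K)%N by rewrite card_prod card_ord card_V.
have cVV : #|{: V * V}| = (K * K)%N by rewrite card_prod card_V.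
have B1 : drawE (fun Z => (many_copies Z)%:R) <= expR (- (2 * y)) :> R.
  apply: (e2 _ _ cVK) => -[v f] /=.
  apply: (le_trans (@hits_many_tail R _ K K_gt0 (block M [set v]) [set f] 10 _)).
    by rewrite card_block !cards1 !mul1n muln1 M_gt0.
  rewrite card_block !cards1 mul1n mulr1.
  (* Ten copies give [expR (1 - 5 * y)], which is below [expR (- (4 * y))] as [y >= 1]. *)
  apply: (@le_trans _ _ (expR 1 * expR (- (y / 2)) ^+ 10)).
    by rewrite ler_pM2l ?expR_gt0 // lerXn2r ?nnegrE ?expR_ge0 // divr_ge0.
  by rewrite -expRM_natl -expRD ler_expR; lra.
have B2 : drawE (fun Z => (few_holders Z)%:R) <= expR (- (2 * y)) :> R.
  apply: (e2 _ _ cVK) => -[u f] /=.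
  apply: le_trans (hits_lower_tail K_gt0 _ _ _) _.
  by rewrite hb ler_expR; have /andP[] := ball_r u; lra.
have B3 : drawE (fun Z => (many_holders Z)%:R) <= expR (- (2 * y)) :> R.
  apply: (e2 _ _ cVK) => -[u f] /=.
  apply: le_trans (hits_upper_tail K_gt0 _ _ _) _.
  by rewrite hb ler_expR; have /andP[] := ball_r u; lra.
have B4 : drawE (fun Z => (many_near_holders Z)%:R) <= expR (- (2 * y)) :> R.
  apply: (e2 _ _ cVK) => -[u f] /=.
  apply: le_trans (hits_upper_tail K_gt0 _ _ _) _.
  by rewrite hb ler_expR; have := ball_rho u; lra.
have B5 : drawE (fun Z => (many_shared Z)%:R) <= expR (- (2 * y)) :> R.
  apply: (e2 _ _ cVV) => -[v w] /=; have [_|vw] := eqVneq v w.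
    by rewrite /drawE big1 ?expR_ge0 // => Z _; rewrite mulr0.
  by apply: le_trans (shared_tail M K_gt0 _ vw) _; rewrite ler_expR; lra.
apply: (@le_trans _ _ (drawE (fun Z => (many_copies Z)%:R + ((few_holders Z)%:R +
    ((many_holders Z)%:R + ((many_near_holders Z)%:R + (many_shared Z)%:R)))))).
  apply: drawE_le => Z; rewrite /good.
  by do ![case: (_ Z)] => /=; rewrite ?mulr1n ?mulr0n; lra.
have drawED (f g : placement V K M -> R) :
    drawE (fun Z => f Z + g Z) = drawE f + drawE g.
  by rewrite /drawE -big_split /=; apply: eq_bigr => Z _; rewrite mulrDr.
by rewrite !drawED; lra.
Qed.


End GoodPlacement.

(** * Asymptotic estimates *)

Lemma expR_ge_sqr {R : realType} (x : R) : 0 <= x -> x ^+ 2 / 2 <= expR x.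
Proof. by move=> /(expR_ge1Dxn 1); rewrite -[2`!%N]/2%N; lra. Qed.

Lemma half_le_expR {R : realType} : 2^-1 <= expR (- 2^-1) :> R.
Proof. by apply: le_trans (expR_ge1Dx _); lra. Qed.

Lemma expR_half_le2 {R : realType} : expR 2^-1 <= 2 :> R.
Proof. by have /= := @expR_le1D2x R 2^-1; rewrite lexx invr_ge0 ler0n => /(_ isT); lra. Qed.

Section Scales.

Context {R : realType} (alpha z : R).
Hypothesis halpha : 0 < alpha < 2^-1.
Hypothesis hz : 300 ^+ 3 <= z * alpha ^+ 2.

(* [y] is [log n]; [theta] is the exponent of the exponential moments and [d]
   the level below which the masses need not be followed. *)
Let y := expR z.
Let theta := expR (alpha * y) / 2.
Let d := expR (- (alpha / 2 * y)).

Lemma scale_facts : [/\ 300 ^+ 3 <= z, 300 ^+ 3 <= z * alpha, z <= y & z ^+ 2 / 2 <= y].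
Proof.
have /andP[a0 a2] := halpha; have hz' := hz.
have z0 : 0 <= z.
  by rewrite leNgt; apply/negP => z0; have := sqr_ge0 alpha; nra.
have za : z * alpha ^+ 2 <= z * alpha by rewrite ler_wpM2l // expr2; nra.
have za' : z * alpha <= z by nra.
split; [lra|lra| |exact: expR_ge_sqr].
by have := expR_ge1Dx z; rewrite /y; lra.
Qed.

(** The product is [expR (alpha / 2 * y) / 2], and the quadratic lower bound on the exponential
    beats [10 * y] once [alpha ^+ 2 * y] is large. *)
Lemma theta_d : 10 * y <= theta * d.
Proof.
have [z1 z2 zy _] := scale_facts; have /andP[a0 a2] := halpha; have hz' := hz.
have y0 : 0 < y by exact: expR_gt0.
rewrite /theta /d mulrAC -expRD.
have -> : alpha * y + - (alpha / 2 * y) = alpha / 2 * y by lra.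
have : 0 <= alpha / 2 * y by rewrite !mulr_ge0 // ltW.
move=> /expR_ge_sqr; rewrite exprMn.
have : 300 ^+ 3 <= alpha ^+ 2 * y.
  by apply: (le_trans hz'); rewrite mulrC ler_wpM2l // exprn_ge0 // ltW.
by rewrite exprMn; move: (alpha ^+ 2) => t ty; nra.
Qed.

Lemma d_le8 : 0 < d <= 8^-1.
Proof.
have [z1 z2 zy _] := scale_facts; have /andP[a0 a2] := halpha.
rewrite expR_gt0 /d expRN lef_pV2 ?posrE ?expR_gt0 //=.
apply: le_trans (expR_ge1Dx _).
have : z * alpha <= y * alpha by rewrite ler_wpM2r // ltW.
by lra.
Qed.

Lemma d_exp k : 10 / alpha <= k%:R -> d ^+ k <= expR (- (5 * y)).
Proof.
have /andP[a0 a2] := halpha; have y0 : 0 < y by exact: expR_gt0.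
rewrite ler_pdivrMr // => ka; rewrite /d -expRM_natl ler_expR.
rewrite mulrN lerN2; move: ka; move: (k%:R) => t ta; nra.
Qed.

(** From [expR 2^-1 <= 2] follows [2 ^+ i >= expR z = y], so about [2 * log log n] squarings reach
    the floor. *)
Lemma layers_le i : 2 * z <= i%:R -> 2^-1 ^+ (2 ^ i) / 8 <= d.
Proof.
have /andP[a0 a2] := halpha; have y0 : 0 < y by exact: expR_gt0.
move=> iz.
have i2 : y <= 2 ^+ i.
  apply: (@le_trans _ _ (expR 2^-1 ^+ i)).
    by rewrite -expRM_natl ler_expR; lra.
  by rewrite lerXn2r ?nnegrE ?expR_ge0 // expR_half_le2.
apply: (@le_trans _ _ (2^-1 ^+ (2 ^ i))).
  by rewrite ler_pdivrMr // ler_peMr ?exprn_ge0 ?invr_ge0 // ler1n.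
apply: (@le_trans _ _ (expR (- 2^-1) ^+ (2 ^ i))).
  by rewrite lerXn2r ?nnegrE ?expR_ge0 ?invr_ge0 // half_le_expR.
by rewrite -expRM_natl ler_expR natrX mulrN lerN2; nra.
Qed.

Lemma upper_failure i k : 2 * z <= i%:R <= 2 * z + 1 -> 10 / alpha <= k%:R ->
  expR y * (i.+1%:R * expR (- (theta * d / 2))
    + expR 2 * Num.max (2^-1 ^+ (2 ^ i) / 8) d ^+ k) <= 2 * expR (- (2 * y)).
Proof.
move=> /andP[iz iz'] ka.
have [z1 z2 zy zzy] := scale_facts; have td := theta_d.
have /andP[d0 d8] := d_le8.
have -> : Num.max (2^-1 ^+ (2 ^ i) / 8) d = d by apply/max_idPr/layers_le.
have i1 : i.+1%:R <= expR y.
  rewrite -natr1; apply: le_trans (expR_ge1Dx _).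
  have : 300 ^+ 3 * z <= z ^+ 2 by rewrite expr2 ler_wpM2r //; lra.
  by lra.
have -> : 2 * expR (- (2 * y)) = expR y * (expR (- (3 * y)) + expR (- (3 * y))).
  have e3 : expR y * expR (- (3 * y)) = expR (- (2 * y)) by rewrite -expRD; congr expR; lra.
  by rewrite mulrDr e3; lra.
rewrite ler_pM2l ?expR_gt0 //; apply: lerD.
  apply: (@le_trans _ _ (expR y * expR (- (5 * y)))).
    by apply: ler_pM; rewrite ?expR_ge0 // ler_expR; lra.
  by rewrite -expRD ler_expR; lra.
apply: (@le_trans _ _ (expR 2 * expR (- (5 * y)))).
  by rewrite ler_pM2l ?expR_gt0 // d_exp.
by rewrite -expRD ler_expR; lra.
Qed.

(** For [k <= z / 2] the power [2 ^+ k] is at most [expR (z / 2)], the square root of [y]. With [w]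
    of order [z] this gives [w * 2 ^+ k <= alpha / 2 * y], so the final mass is still at least [d]
    and [theta_d] applies. *)
Lemma lower_failure k : (0 < k)%N -> k%:R <= z / 2 ->
  k%:R * (expR y * expR (- (theta * (32 * k%:R * (1440^-1 / (32 * k%:R)) ^+ (2 ^ k)))))
  <= expR (- (2 * y)).
Proof.
move=> k0 kz; have /andP[a0 a2] := halpha.
have [z1 z2 zy zzy] := scale_facts; have td := theta_d.
have y0 : 0 < y by exact: expR_gt0.
have k1 : 1 <= k%:R :> R by rewrite ler1n.
pose w : R := 32 * 1440 * k%:R.
have w0 : 0 < w by rewrite /w; lra.
have wV : expR (- w) <= 1440^-1 / (32 * k%:R).
  have -> : 1440^-1 / (32 * k%:R) = w^-1 by rewrite /w; field; rewrite pnatr_eq0 -lt0n.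
  by rewrite expRN lef_pV2 ?posrE ?expR_gt0 //; have := expR_ge1Dx w; lra.
move: wV; move: (1440^-1 / _) => q wV.
have q0 : 0 <= q by apply: le_trans wV; exact: expR_ge0.
have k2 : 2 ^+ k <= expR (z / 2).
  apply: (@le_trans _ _ (expR k%:R)); last by rewrite ler_expR.
  rewrite -[k%:R]mulr1 expRM_natl lerXn2r ?nnegrE ?expR_ge0 //.
  by have := expR_ge1Dx (1 : R); lra.
have wd : w * 2 ^+ k <= alpha / 2 * y.
  have ez : (z / 2) ^+ 2 / 2 <= expR (z / 2) by apply: expR_ge_sqr; lra.
  have yz : y = expR (z / 2) * expR (z / 2) by rewrite -expRD /y; congr expR; lra.
  rewrite yz; set t := expR (z / 2) in k2 ez *.
  have t0 : 0 < t by exact: expR_gt0.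
  apply: (@le_trans _ _ (32 * 1440 * (z / 2) * t)).
    apply: ler_pM => //; [exact: ltW|].
    by rewrite /w; lra.
  rewrite [leRHS]mulrA ler_wpM2r ?(ltW t0) //.
  apply: (@le_trans _ _ (alpha / 2 * ((z / 2) ^+ 2 / 2))); last first.
    by rewrite ler_wpM2l // divr_ge0 // ltW.
  have : 300 ^+ 3 * z <= (z * alpha) * z by rewrite ler_wpM2r //; lra.
  by lra.
have dX : d <= q ^+ (2 ^ k).
  apply: (@le_trans _ _ (expR (- w) ^+ (2 ^ k))).
    by rewrite -expRM_natl /d ler_expR natrX; lra.
  by rewrite lerXn2r ?nnegrE ?expR_ge0.
move: dX; move: (q ^+ (2 ^ k)) => X dX.
have X0 : 0 <= X by apply: le_trans dX; exact: expR_ge0.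
have th0 : 0 <= theta by rewrite divr_ge0 ?expR_ge0.
have tX : theta * d <= theta * (32 * k%:R * X).
  rewrite ler_wpM2l //; apply: (le_trans dX); rewrite ler_peMl //; lra.
apply: (@le_trans _ _ (expR y * (expR y * expR (- (10 * y))))); last first.
  by rewrite -!expRD ler_expR; lra.
apply: ler_pM => //.
  by apply: le_trans (expR_ge1Dx _); lra.
by rewrite ler_pM2l ?expR_gt0 // ler_expR; lra.
Qed.

Lemma cost_failure : expR (- (expR y / 8)) <= expR (- (2 * y)).
Proof.
have [z1 z2 zy zzy] := scale_facts.
rewrite ler_expR lerN2; have : y ^+ 2 / 2 <= expR y by apply: expR_ge_sqr; lra.
have : 300 ^+ 3 * y <= y ^+ 2 by rewrite expr2 ler_wpM2r //; lra.
by lra.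
Qed.

Lemma total_failure : 9 * expR (- (2 * y)) <= expR (- y).
Proof.
have [z1 z2 zy zzy] := scale_facts.
have -> : expR (- (2 * y)) = expR (- y) * expR (- y) by rewrite -expRD; congr expR; lra.
rewrite mulrA ler_piMl ?expR_ge0 //.
rewrite expRN ler_pdivrMr ?expR_gt0 // mul1r.
by apply: le_trans (expR_ge1Dx _); lra.
Qed.

End Scales.

Lemma le_natS_truncn {R : realType} (x : R) : 0 <= x ->
  x <= (Num.truncn x).+1%:R <= x + 1.
Proof. by move=> /truncn_itv /andP[h1 h2]; rewrite (ltW h2) -natr1 lerD2r. Qed.

Lemma exists_nat_ge {R : realType} (x : R) : exists k : nat, x <= k%:R.
Proof.
have [/le_natS_truncn/andP[h _]|/ltW h] := leP 0 x; last by exists 0%N.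
by exists (Num.truncn x).+1.
Qed.

(** Rounding the phase length down loses fewer than [k] requests in total, at most half of them. *)
Lemma divn_phases k n : (0 < k)%N -> (2 * k <= n)%N ->
  (k * (n %/ k) <= n <= 2 * k * (n %/ k))%N.
Proof.
move=> k0 kn; rewrite mulnC leq_divM /= -mulnA [(k * _)%N]mulnC.
have := ltn_ceil n k0; rewrite mulSn; move: (n %/ k * k)%N => p; lia.
Qed.

(** * The parameters of the theorem on the torus *)

Section TorusScales.

(* [y] is [log n] and [z] is [log (log n)]. *)
Context {R : realType} (alpha beta y z : R) (m : nat).
Hypothesis halpha : 0 < alpha < 2^-1.
Hypothesis hbeta : 0 < beta < 2^-1.
Hypothesis m_y : (m ^ 2)%:R = expR y.
Hypothesis y_z : y = expR z.
Hypothesis hz : 300 ^+ 3 <= z * alpha ^+ 2.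
Hypothesis hzb : 300 <= z * beta.
Hypothesis size_cond : 1 + 2 * z / y <= alpha + 2 * beta.

Let n := (m ^ 2)%N.
Let x := expR (alpha * y).
Let r := expR (beta * y).
Let M := Num.truncn x.
Let rho := r / 300.
Let lam := r ^+ 2 * x / n%:R.

Let y0 : 0 < y. Proof. by rewrite y_z expR_gt0. Qed.
Let x0 : 0 < x. Proof. exact: expR_gt0. Qed.
Let r0 : 0 < r. Proof. exact: expR_gt0. Qed.
Let n0 : 0 < n%:R :> R. Proof. by rewrite m_y expR_gt0. Qed.

Lemma M_bounds : x / 2 <= M%:R <= x.
Proof.
have /andP[a0 _] := halpha.
have x1 : 1 <= x by rewrite -expR0 ler_expR mulr_ge0 // ltW.
have /andP[h1 h2] := truncn_itv (ltW x0).
have M1 : 1 <= M%:R :> R by rewrite ler1n truncn_gt0.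
apply/andP; split => //; move: h2 M1; rewrite -/M -natr1; move: (M%:R) => t h3 h4; lra.
Qed.

Lemma M_gt0 : (0 < M)%N.
Proof.
have /andP[a0 _] := halpha.
by rewrite truncn_gt0 -expR0 ler_expR mulr_ge0 // ltW.
Qed.

Lemma m_exp : m%:R = expR (y / 2).
Proof.
have : m%:R ^+ 2 = expR (y / 2) ^+ 2 :> R.
  by rewrite -natrX m_y -expRM_natl mulrC divfK // pnatr_eq0.
by move/eqP; rewrite eqrXn2 ?expR_ge0 // => /eqP.
Qed.

Lemma r_lt_m : r < m%:R.
Proof.
have /andP[_ b2] := hbeta.
by rewrite m_exp /r ltr_expR mulrC ltr_pM2l.
Qed.

Lemma r_ge300 : 300 <= r.
Proof.
have zy : z <= y by rewrite y_z; have := expR_ge1Dx z; lra.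
have /andP[b0 _] := hbeta.
have : 300 <= beta * y by apply: (le_trans hzb); rewrite mulrC ler_wpM2l // ltW.
by move=> h; apply: le_trans (expR_ge1Dx _); lra.
Qed.

(** Here the size condition enters: multiplied by [y], it says that the exponent of [lam] is at
    least [2 * z]. *)
Lemma lam_ge : y ^+ 2 <= lam.
Proof.
have -> : lam = expR (2 * (beta * y) + alpha * y - y).
  by rewrite /lam m_y /r /x expRD expRN expRD expRM_natl.
rewrite [in leLHS]y_z -expRM_natl ler_expR.
have : (1 + 2 * z / y) * y <= (alpha + 2 * beta) * y by rewrite ler_wpM2r // ltW.
by rewrite mulrDl mul1r divfK ?gt_eqF //; lra.
Qed.

Lemma lam_gt0 : 0 < lam.
Proof. by rewrite divr_gt0 // mulr_gt0 // exprn_gt0. Qed.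

Lemma lam_large : 300 ^+ 3 * y <= lam.
Proof.
have [z1 _ zy _] := scale_facts halpha hz.
apply: le_trans lam_ge; rewrite expr2 ler_wpM2r ?(ltW y0) //.
by rewrite y_z; exact: le_trans zy.
Qed.

Lemma M_div_small : M%:R / n%:R <= expR (- (y / 2)).
Proof.
have /andP[_ xM] := M_bounds; have /andP[_ a2] := halpha.
rewrite ler_pdivrMr // m_y -expRD; apply: (le_trans xM); rewrite ler_expR.
have : alpha * y <= 2^-1 * y by rewrite ler_wpM2r // ltW.
by lra.
Qed.

Local Notation B t u := (#|ball_of (@torus_adj m) t u|%:R).

Lemma ball_r_bounds u : (r / 2) ^+ 2 <= B r u <= (3 * r) ^+ 2.
Proof.
by apply: torus_ball_bounds r_lt_m; apply: le_trans r_ge300; rewrite ler1n.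
Qed.

Lemma holders_mean u : lam / 8 <= B r u * M%:R / n%:R <= 9 * lam.
Proof.
have /andP[h1 h2] := ball_r_bounds u; have /andP[xM1 xM2] := M_bounds.
have n_neq0 : n%:R != 0 :> R by rewrite gt_eqF.
apply/andP; split.
  rewrite ler_pdivlMr // [leLHS](_ : _ = (r / 2) ^+ 2 * (x / 2)); last first.
    by rewrite /lam; field.
  by apply: ler_pM => //; rewrite ?exprn_ge0 ?divr_ge0 ?(ltW r0) ?(ltW x0).
rewrite ler_pdivrMr // [leRHS](_ : _ = (3 * r) ^+ 2 * x); last by rewrite /lam; field.
by apply: ler_pM.
Qed.

Lemma near_holders_mean u : B rho u * M%:R / n%:R <= lam / 100 ^+ 2.
Proof.
have rho1 : 1 <= rho by rewrite ler_pdivlMr ?ltr0n // mul1r r_ge300.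
have rhom : rho < m%:R.
  by apply: le_lt_trans r_lt_m; rewrite ler_piMr ?(ltW r0) ?invf_le1 ?ltr0n ?ler1n.
have /andP[_ h] := torus_ball_bounds u rho1 rhom; have /andP[_ xM] := M_bounds.
have n_neq0 : n%:R != 0 :> R by rewrite gt_eqF.
rewrite ler_pdivrMr // [leRHS](_ : _ = (3 * rho) ^+ 2 * x); last by rewrite /lam /rho; field.
by apply: ler_pM.
Qed.

(** The powers of [r], [x] and [n] collapse to [y / lam] times a constant, which [lam_large] makes
    small. *)
Lemma theta_pair_weight :
  x / 2 * (2 * (3 * r) ^+ 2 * (12 * y) / (n%:R * (lam / 288) ^+ 2)) <= 2^-1.
Proof.
have n_neq0 : n%:R != 0 :> R by rewrite gt_eqF.
have l0 := lam_gt0; have ly := lam_large.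
rewrite [leLHS](_ : _ = 108 * 288 ^+ 2 * y / lam).
  by rewrite ler_pdivrMr //; lra.
by rewrite /lam; field; rewrite n_neq0 !gt_eqF.
Qed.

(** The constant is [4 * 2 * 9 * 20]: ball size, rounding of [M], copies per server, number of
    candidates. *)
Lemma mass_lower : 1440^-1 <= (r / 2) ^+ 2 * M%:R / (n%:R * 9 * (20 * lam)).
Proof.
have n_neq0 : n%:R != 0 :> R by rewrite gt_eqF.
have l0 := lam_gt0; have /andP[xM _] := M_bounds.
rewrite ler_pdivlMr; last by apply: mulr_gt0; apply: mulr_gt0 => //.
rewrite [leLHS](_ : _ = (r / 2) ^+ 2 * (x / 2)); last by rewrite /lam; field.
by apply: ler_pM => //; rewrite ?exprn_ge0 ?divr_ge0 ?(ltW r0) ?(ltW x0).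
Qed.

Lemma mass_upper : (3 * r) ^+ 2 * M%:R / (n%:R * (lam / 288)) <= 36 * 72.
Proof.
have n_neq0 : n%:R != 0 :> R by rewrite gt_eqF.
have l0 := lam_gt0; have /andP[_ xM] := M_bounds.
rewrite ler_pdivrMr; last by apply: mulr_gt0 n0 _; rewrite divr_gt0 ?ltr0n.
rewrite [leRHS](_ : _ = (3 * r) ^+ 2 * x); last by rewrite /lam; field.
by rewrite ler_wpM2l ?sqr_ge0.
Qed.

Lemma n_gt0 : (0 < n)%N. Proof. by rewrite -(ltr0n R). Qed.

Lemma card_torus : #|{: 'I_m * 'I_m}| = n.
Proof. by rewrite card_prod !card_ord mulnn. Qed.

Lemma torus_good_placement :
  drawE (fun Z : placement ('I_m * 'I_m)%type n M =>
    (~~ good (@torus_adj m) r rho lam y Z)%:R) <= 5 * expR (- (2 * y)).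
Proof.
have [z1 _ zy _] := scale_facts halpha hz.
apply: bad_placement n_gt0 card_torus m_y _ M_gt0 M_div_small holders_mean near_holders_mean _.
  by rewrite y_z; lra.
by apply: le_trans lam_large; rewrite ler_wpM2r ?(ltW y0) //; lra.
Qed.

(** Of the four units of failure, two come from the upper bound on the load, one from the lower
    bound and one from the cost. *)
Lemma torus_run_failure (j0 i k kl : nat) (Z : placement ('I_m * 'I_m)%type n M) :
  good (@torus_adj m) r rho lam y Z ->
  128 * (36 * 72) ^+ 2 <= j0%:R :> R -> 2 * z <= i%:R <= 2 * z + 1 ->
  10 / alpha <= k%:R -> z / 4 <= kl%:R <= z / 2 ->
  \sum_(qs : n.-tuple (request ('I_m * 'I_m)%type n))
     (\prod_(q <- qs) request_pr (@torus_adj m) (@unif_popularity R n) r Z q) *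
     (~~ ((kl <= max_load (Z, qs) < j0 + i + k)%N &&
          (rho / 4 <= comm_cost (@torus_adj m) (Z, qs) <= r)))%:R
  <= 4 * expR (- (2 * y)).
Proof.
move=> gZ hj0 hi hk /andP[kl1 kl2].
have [z1 _ zy _] := scale_facts halpha hz.
have kl0 : (0 < kl)%N by rewrite -(ltr0n R); apply: lt_le_trans kl1; lra.
have up := upper_failure halpha hz hi hk.
have low := lower_failure halpha hz kl0 kl2.
have cst := cost_failure halpha hz.
rewrite -y_z in up low cst zy.
have l0 := lam_gt0.
have cand2 u f : (1 < #|candidates (@torus_adj m) r Z u f|)%N.
  rewrite -(ltr1n R); have /andP[h _] := good_candidates gZ u f.
  apply: lt_le_trans h; rewrite ltr_pdivlMr ?ltr0n // mul1r.
  by apply: lt_le_trans lam_large; lra.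
have LA0 : 0 < lam / 288 by rewrite divr_gt0 ?ltr0n.
have rho0 : 0 < rho by rewrite divr_gt0 ?ltr0n.
have V0 : (0 < #|{: 'I_m * 'I_m}|)%N by rewrite card_torus n_gt0.
have bl0 : 0 <= (r / 2) ^+ 2 by rewrite exprn_ge0 // divr_ge0 // ltW.
have hd := d_le8 halpha hz; rewrite -y_z in hd.
have kln : (kl * (n %/ kl) <= n <= 2 * kl * (n %/ kl))%N.
  have kln : (2 * kl <= n)%N.
    rewrite -(ler_nat R) natrM m_y; apply: (le_trans _ (expR_ge1Dx _)).
    by lra.
  exact: divn_phases.
have c01 : 0 < (1440^-1 : R) <= 1 by rewrite invr_gt0 ltr0n invf_le1 ?ltr0n ?ler1n.
have C1 : 1 <= 36 * 72 :> R by lra.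
have tau0 : 0 <= 12 * y by rewrite mulr_ge0 // ltW.
have th0 : 0 <= x / 2 by rewrite divr_ge0 // ltW.
have := @run_failure R _ (@torus_adj m) n M r Z V0 n_gt0 (@torus_adj_sym m) cand2
  _ _ _ _ _ _ LA0 (good_candidates gZ) ball_r_bounds bl0 (good_shared gZ) (ltr0n R 9)
  (good_stored gZ) rho rho0 (good_near gZ) (x / 2) 1440^-1 (36 * 72)
  (expR (- (alpha / 2 * y))) j0 i k kl (n %/ kl) n card_torus
  tau0 th0 theta_pair_weight c01 mass_lower C1 mass_upper hd hj0 kl0 kln.
move=> /le_trans; apply; rewrite m_y.
by lra.
Qed.

End TorusScales.

Theorem theorem4 (R : realType) (alpha beta : R)
    (halpha : 0 < alpha < 2^-1) (hbeta : 0 < beta < 2^-1) :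
  exists c a1 a2 b1 b2 : R,
    [/\ 0 < c, 0 < a1, 0 < a2, 0 < b1 & 0 < b2] /\
    exists m0 : nat, forall m : nat, (m0 <= m)%N ->
      let n := (m ^ 2)%N in
      let K := n in
      let M := Num.truncn (n%:R `^ alpha : R) in
      let r := n%:R `^ beta : R in
      1 + 2 * ln (ln n%:R) / ln n%:R <= alpha + 2 * beta ->
      1 - 1 / n%:R `^ c <=
        Pr (@torus_adj m) (@unif_popularity R K) r
          (fun w : outcome ('I_m * 'I_m)%type K M n =>
             (a1 * ln (ln n%:R) <= (max_load w)%:R <= a2 * ln (ln n%:R))
             && (b1 * r <= comm_cost (@torus_adj m) w <= b2 * r)).
Proof.
have /andP[a0 a2] := halpha; have /andP[b0 b2] := hbeta.
have [j0 hj0] := exists_nat_ge (128 * (36 * 72) ^+ 2 : R).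
have [k hk] := exists_nat_ge (10 / alpha).
(* The threshold is put on [log log n]; hence [m0] is a double exponential. *)
have [Z0 [hZa hZb]] : exists Z0, 300 ^+ 3 / alpha ^+ 2 <= Z0 /\ 300 / beta <= Z0.
  by exists (Num.max (300 ^+ 3 / alpha ^+ 2) (300 / beta)); rewrite !le_max !lexx orbT.
have [m0 hm0] := exists_nat_ge (expR (expR Z0)).
(* The load is at least [kl >= z / 4] and below [j0 + i + k] with [i <= 2 * z + 1], where [z >= 1]
   absorbs the constants. The cost lies between [rho / 4], with [rho = r / 300], and [r]. *)
exists 1, 4^-1, (j0 + k + 3)%:R, 1200^-1, 1.
split; first by rewrite !invr_gt0 !ltr0n addn3.
exists m0 => m m0m n K M r cond.
have m_large : expR (expR Z0) <= m%:R by apply: (le_trans hm0); rewrite ler_nat.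
have m_gt0 : (0 < m)%N by rewrite -(ltr0n R); apply: lt_le_trans m_large; exact: expR_gt0.
have n0 : 0 < n%:R :> R by rewrite ltr0n expn_gt0 m_gt0.
have ny : n%:R = expR (ln n%:R) :> R by rewrite lnK // posrE.
rewrite /n /K /M /r -/n in cond *; move: cond; set y : R := ln n%:R in ny *.
have yZ : expR Z0 <= y.
  rewrite -ler_expR -ny; apply: (le_trans m_large).
  by rewrite ler_nat -[leqLHS]expn1 leq_pexp2l.
have y0 : 0 < y by apply: lt_le_trans yZ; exact: expR_gt0.
have yz : y = expR (ln y) by rewrite lnK // posrE.
set z := ln y in yz *; move=> cond.
have zZ : Z0 <= z by rewrite -ler_expR -yz.
have hz : 300 ^+ 3 <= z * alpha ^+ 2.
  by rewrite -ler_pdivrMr ?exprn_gt0 //; exact: le_trans zZ.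
have hzb : 300 <= z * beta by rewrite -ler_pdivrMr //; exact: le_trans zZ.
have powE a : n%:R `^ a = expR (a * y) by rewrite /powR gt_eqF.
rewrite !powE div1r (mul1r y) -expRN.
have [z1 _ _ _] := scale_facts halpha hz.
have [i hi] : exists i : nat, 2 * z <= i%:R <= 2 * z + 1.
  by exists (Num.truncn (2 * z)).+1; apply: le_natS_truncn; lra.
have [kl hkl] : exists kl : nat, z / 4 <= kl%:R <= z / 2.
  have z2 : 0 <= z / 2 by lra.
  exists (Num.truncn (z / 2)); have /andP[h1 h2] := truncn_itv z2.
  by apply/andP; split=> //; move: h2; rewrite -[X in _ < X]natr1; lra.
apply: le_trans (Pr_ge (t := 4 * expR (- (2 * y))) (good := good (@torus_adj m) (expR (beta * y)) (expR (beta * y) / 300)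
   (expR (beta * y) ^+ 2 * expR (alpha * y) / n%:R) y) _ _ _ _).
(* Placement and requests fail with total probability at most [(5 + 4) * expR (- (2 * y))], below
   [expR (- y) = 1 / n]. *)
- rewrite lerD2l lerN2.
  have bad := torus_good_placement halpha hbeta ny yz hz hzb cond.
  have tot := total_failure halpha hz; rewrite -yz in tot.
  by apply: le_trans tot; apply: (le_trans (lerD bad (lexx _))); lra.
- by rewrite card_torus expn_gt0 m_gt0.
- by rewrite expn_gt0 m_gt0.
- by rewrite mulr_ge0 ?expR_ge0.
move=> Z gZ.
apply: le_trans (torus_run_failure halpha hbeta ny yz hz hzb cond gZ hj0 hi hk hkl).
apply: ler_sum => qs _; apply: ler_wpM2l.
  by apply: prodr_ge0 => q _; apply: request_pr_ge0; rewrite ?card_torus expn_gt0 m_gt0.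
rewrite ler_nat; set A := (X in (~~ X <= _)%N); set B := (X in (_ <= ~~ X)%N).
suff BA : B -> A by move: BA; case: A; case: B => // /(_ isT).
rewrite /A /B => /andP[/andP[m1 m2] /andP[c1 c2]].
rewrite mul1r c2 andbT; apply/andP; split; last first.
  by apply: le_trans c1; rewrite mulrC -mulrA -invfM -natrM.
have /andP[kl1 _] := hkl; have /andP[_ i2] := hi.
apply/andP; split.
  by rewrite mulrC; apply: (le_trans kl1); rewrite ler_nat.
apply: (@le_trans _ _ ((j0 + i + k)%:R)); first by rewrite ler_nat ltnW.
rewrite !natrD; have : 0 <= j0%:R * (z - 1) by rewrite mulr_ge0 //; lra.
have : 0 <= k%:R * (z - 1) by rewrite mulr_ge0 //; lra.
by lra.
Qed.
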